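(* Let $0<c<1$ and $c'=\frac{1}{2}\log(1-c)+\frac{c}{2}+\frac{c^2}{4}+\frac{c^4}{8}$. Then $$\lim_{n\to\infty}\Pr[M(n,c,3)=-1]=1-e^{c'}\quad\text{and}\quad\lim_{n\to\infty}\Pr[M(n,c,3)=0]=e^{c'}.$$
   Context: $G(n,p)$ is the Erdős–Rényi random graph on $n$ vertices with each edge present independently with probability $p$; $K_3$ is the triangle; $\log$ is the natural logarithm. For graphs $G,H$, $\mathrm{Hom}(G,H)$ is the polyhedral complex whose cells are functions $\eta:V(G)\to 2^{V(H)}\setminus\{\varnothing\}$ with $\eta(x)\times\eta(y)\subseteq E(H)$ whenever $\{x,y\}\in E(G)$; the cell $\eta$ is a product of simplices of dimension $\sum_v(|\eta(v)|-1)$, with face relation $\eta\subseteq\tau$ iff $\eta(v)\subseteq\tau(v)$. For a space $X$, $\mathrm{conn}(X)$ is the largest $j$ such that $X$ is $j$-connected, where $X$ is $j$-connected if it is nonempty (for $j\ge-1$) and $\pi_i(X)$ vanishes for $0\le i\le j$; thus a nonempty disconnected space has $\mathrm{conn}=-1$ and a path-connected space with nontrivial $\pi_1$ has $\mathrm{conn}=0$. $M(n,c,m):=\mathrm{conn}[\mathrm{Hom}(G(n,c/n),K_m)]$. *)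

(* Defs.v *)
From HB Require Import structures.
From mathcomp Require Import all_boot all_order all_algebra.
From mathcomp Require Import all_classical all_reals all_analysis.
Set Implicit Arguments. Unset Strict Implicit. Unset Printing Implicit Defensive.
Import Order.TTheory GRing.Theory Num.Theory.
Import numFieldNormedType.Exports.
Local Open Scope classical_set_scope.
Local Open Scope ring_scope.

Section Topo.
Context {R : realType} {T : topologicalType}.

Definition path_in (X : set T) (a b : T) : Prop :=
  exists g : R -> T,
    [/\ {within `[0, 1], continuous g}, g 0 = a, g 1 = b &
        g @` `[0, 1] `<=` X].

Definition loop_nullhomotopic (X : set T) (a : T) (g : R -> T) : Prop :=
  exists H : R * R -> T,
    [/\ {within `[0, 1] `*` `[0, 1], continuous H},
        H @` (`[0, 1] `*` `[0, 1]) `<=` X,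
        (forall t, t \in `[0, 1] -> H (t, 0) = g t /\ H (t, 1) = a) &
        (forall s, s \in `[0, 1] -> H (0, s) = a /\ H (1, s) = a)].

Definition zero_connected (X : set T) : Prop :=
  X !=set0 /\ forall a b, X a -> X b -> path_in X a b.

Definition one_connected (X : set T) : Prop :=
  zero_connected X /\
  forall (a : T) (g : R -> T),
    X a -> {within `[0, 1], continuous g} -> g 0 = a -> g 1 = a ->
    g @` `[0, 1] `<=` X -> loop_nullhomotopic X a g.

Definition conn_eq_m1 (X : set T) : Prop := X !=set0 /\ ~ zero_connected X.
Definition conn_eq_0 (X : set T) : Prop := zero_connected X /\ ~ one_connected X.
End Topo.

Definition hom_cell (n m : nat) (G : rel 'I_n) (H : rel 'I_m)
    (eta : {ffun 'I_n -> {set 'I_m}}) : bool :=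
  [forall x, eta x != finset.set0] &&
  [forall x, forall y, G x y ==>
     [forall a, forall b, ((a \in eta x) && (b \in eta y)) ==> H a b]].

(* The closed cell |eta| = prod_v Delta(eta v), as points M of ('Delta^{m-1})^n
   (row v of M is a point of the simplex on V(H) supported in eta v). *)
Definition cell_realization (R : realType) (n m : nat)
    (eta : {ffun 'I_n -> {set 'I_m}}) : set 'M[R]_(n, m) :=
  [set M | forall v : 'I_n,
     (forall k, 0 <= M v k) /\ (\sum_k M v k = 1) /\
     (forall k, k \notin eta v -> M v k = 0)].

Definition Hom_space (R : realType) (n m : nat) (G : rel 'I_n) (H : rel 'I_m)
    : set 'M[R]_(n, m) :=
  \bigcup_(eta in [set eta | hom_cell G H eta]) cell_realization (R:=R) eta.

Definition K (m : nat) : rel 'I_m := fun a b => a != b.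
Arguments K m : clear implicits.

Definition pairs (n : nat) : {set {set 'I_n}} := [set e : {set 'I_n} | #|e| == 2].
Definition graph_of (n : nat) (E : {set {set 'I_n}}) : rel 'I_n :=
  fun x y => (x != y) && ([set x; y]%SET \in E).
Definition gnp_weight {R : realType} (n : nat) (p : R) (E : {set {set 'I_n}}) : R :=
  p ^+ #|E| * (1 - p) ^+ (#|pairs n| - #|E|).
Definition gnp_prob {R : realType} (n : nat) (p : R)
    (P : rel 'I_n -> Prop) : R :=
  \sum_(E : {set {set 'I_n}} | (E \subset pairs n) && `[< P (graph_of E) >])
     gnp_weight p E.

(* Main.v *)
(* For c < 1 every component of G(n, c/n) is, with probability tending to 1, a
   tree or unicyclic.  A point of Hom(G, K_3) is a family of points of a triangle,
   indexed by the vertices, with disjoint supports along edges.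

   If all cycles have length 4, the endpoint of a longest path is a leaf or folds
   onto the vertex two steps further; removing such vertices one by one shows that
   G is bipartite and that its 3-colorings are connected by single-vertex
   recolorings.  Hence Hom(G, K_3) is path-connected, and an edge of G makes it
   retract onto the hexagon Hom(K_2, K_3): the loop that runs once around the
   hexagon is not contractible, by a discrete Stokes argument on a fine grid.

   If G has no bicyclic subgraph but has a k-cycle with k <> 4, then the winding
   number of a 3-coloring along this cycle is constant on path components, takes
   a nonzero value w, and takes the value -w after exchanging two colors.

   Bicyclic subgraphs are excluded by a first moment bound.  The probability that
   all cycles have length 4 is bounded below by Harris' inequality and above by
   Janson's inequality for cycles of bounded length; both bounds converge to
   exp(- sum_(k >= 3, k <> 4) c^k / (2 k)). *)
Require Import Defs.
From HB Require Import structures.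
From mathcomp Require Import all_boot all_order all_algebra.
From mathcomp Require Import all_classical all_reals all_analysis.
From mathcomp Require Import fintype finset ring lra zify.
Import Order.TTheory GRing.Theory Num.Theory.
Import numFieldNormedType.Exports.
Set Implicit Arguments. Unset Strict Implicit. Unset Printing Implicit Defensive.
Local Open Scope ring_scope.

(** * Random subsets: Harris and Janson inequalities *)

(** Length 4 is exceptional because the steps +1 and -1 of a 3-coloring round a k-cycle sum to a
    multiple of 3 with the parity of k and absolute value at most k: for k = 4 only 0 is possible,
    for every other k >= 3 one of 3 and 6 is. The expected number of k-cycles tends to c^k/(2k), and
    the sum over k >= 3, k <> 4 is -log(1-c)/2 without its terms for k = 1, 2, 4, which is -c'.

    Topology enters through uniform continuity. At a point of the complex every vertex of the graph
    has a color of mass at least 1/3; as long as entries move by less than 1/3, colors picked at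
    nearby points belong to one cell. Paths and homotopies thus become finite sequences and grids of
    colorings, whose integer turning numbers are compared by finite case checks.

    The error in Janson's inequality grows with the cycle lengths, so the upper bound fixes a
    maximal length before n tends to infinity. Harris' inequality costs only a factor 1/(1-p) in the
    exponent, uniformly in the lengths, and is applied to all of them. *)

Section RandomSubset.
Variables (R : realType) (p : R) (T : finType).
Hypotheses (p0 : 0 <= p) (p1 : p <= 1).
Implicit Types (s : seq T) (f g : {set T} -> R) (C E : {set T}).

(** Expectation over the random subset of a repetition-free [s] that contains each element
    independently with probability [p]. Conditioning on the head makes the correlation inequalities
    provable by induction on the ground set. *)
Fixpoint Ex s f : R :=
  if s is a :: s' then p * Ex s' (fun E => f (a |: E)) + (1 - p) * Ex s' f
  else f set0.

Lemma eq_Ex s f g : f =1 g -> Ex s f = Ex s g.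
Proof.
elim: s f g => [|a s IH] f g fg /=; first exact: fg.
by congr (_ * _ + _ * _); apply: IH => E; apply: fg.
Qed.

Lemma eq_Ex' s f g : (forall E, E \subset s -> f E = g E) -> Ex s f = Ex s g.
Proof.
elim: s f g => [|a s IH] f g fg /=; first by apply/fg/subsetP => x; rewrite inE.
congr (_ * _ + _ * _); apply: IH => E /subsetP Es; apply: fg.
  apply/subsetP => x; rewrite !inE => /orP[->//|/Es ->].
  by rewrite orbT.
by apply/subsetP => x /Es; rewrite inE orbC => ->.
Qed.

Lemma le_Ex s f g : (forall E, f E <= g E) -> Ex s f <= Ex s g.
Proof.
elim: s f g => [|a s IH] f g fg /=; first exact: fg.
by apply: lerD; apply: ler_wpM2l; rewrite ?subr_ge0 //; apply: IH.
Qed.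

Lemma Ex_const s (k : R) : Ex s (fun=> k) = k.
Proof. by elim: s => //= a s ->; ring. Qed.

Lemma ExD s f g : Ex s (fun E => f E + g E) = Ex s f + Ex s g.
Proof. by elim: s f g => //= a s IH f g; rewrite !IH; ring. Qed.

Lemma ExB s f g : Ex s (fun E => f E - g E) = Ex s f - Ex s g.
Proof. by elim: s f g => //= a s IH f g; rewrite !IH; ring. Qed.

Lemma Ex_sum s (I : Type) (r : seq I) (P : pred I) (F : I -> {set T} -> R) :
  Ex s (fun E => \sum_(i <- r | P i) F i E) = \sum_(i <- r | P i) Ex s (F i).
Proof.
elim: r => [|i r IH].
  by under eq_Ex do rewrite big_nil; rewrite Ex_const big_nil.
rewrite big_cons; case: ifP => Pi.
  by under eq_Ex do rewrite big_cons Pi; rewrite ExD IH.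
by under eq_Ex do rewrite big_cons Pi.
Qed.

Lemma Ex_indep s f g :
  (forall a, a \in s -> (forall E, f (a |: E) = f E) \/
                        (forall E, g (a |: E) = g E)) ->
  Ex s (fun E => f E * g E) = Ex s f * Ex s g.
Proof.
elim: s f g => //= a s IH f g H.
have Hs (h : {set T} -> R) b : (forall E, h (b |: E) = h E) ->
    forall E, h (a |: (b |: E)) = h (a |: E).
  by move=> hb E; rewrite setUCA hb.
rewrite !IH; last 2 first.
- by move=> b bs; apply: H; rewrite inE bs orbT.
- move=> b bs; have [|h|h] := H b; first by rewrite inE bs orbT.
    by left; apply: Hs.
  by right; apply: Hs.
have [|h|h] := H a; first by rewrite mem_head.
  by rewrite (eq_Ex _ h); ring.
by rewrite (eq_Ex _ h); ring.
Qed.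

(** After the induction hypothesis is applied to both conditional expectations, what remains is
    p(1-p)(F1-F0)(G0-G1), nonnegative by the opposite monotonicities. *)
Lemma harris s f g :
  (forall E a, f E <= f (a |: E)) -> (forall E a, g (a |: E) <= g E) ->
  Ex s (fun E => f E * g E) <= Ex s f * Ex s g.
Proof.
elim: s f g => //= a s IH f g Hf Hg.
have Hf1 E b : f (a |: E) <= f (a |: (b |: E)) by rewrite setUCA.
have Hg1 E b : g (a |: (b |: E)) <= g (a |: E) by rewrite setUCA.
have h1 := IH _ _ Hf1 Hg1.
have h0 := IH _ _ Hf Hg.
have F : Ex s f <= Ex s (fun E => f (a |: E)) by apply: le_Ex.
have G : Ex s (fun E => g (a |: E)) <= Ex s g by apply: le_Ex.
set F1 := Ex s (fun E => f (a |: E)) in h1 F *; set F0 := Ex s f in h0 F *.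
set G1 := Ex s (fun E => g (a |: E)) in h1 G *; set G0 := Ex s g in h0 G *.
apply: (@le_trans _ _ (p * (F1 * G1) + (1 - p) * (F0 * G0))).
  have q0 : 0 <= 1 - p by rewrite subr_ge0.
  exact: lerD (ler_wpM2l p0 h1) (ler_wpM2l q0 h0).
rewrite -subr_ge0 (_ : _ - _ = (p * (1 - p)) * ((F1 - F0) * (G0 - G1))).
  by rewrite !mulr_ge0 ?subr_ge0.
by ring.
Qed.

Lemma Ex_sub s C : uniq s -> C \subset s ->
  Ex s (fun E => (C \subset E)%:R) = p ^+ #|C|.
Proof.
elim: s C => [|a s IH] C /=.
  move=> _ /subset_leq_card; rewrite card0 leqn0 cards_eq0 => /eqP->.
  by rewrite sub0set cards0.
move=> /andP[as_ us] Cs.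
have Cs' : C :\ a \subset s.
  apply/subsetP => x; rewrite !inE => /andP[xa /(subsetP Cs)].
  by rewrite inE (negPf xa).
rewrite (@eq_Ex _ _ (fun E => (C :\ a \subset E)%:R)); last first.
  by move=> E; rewrite subDset.
rewrite IH //; have [aC|aC] := boolP (a \in C).
  rewrite (cardsD1 a C) aC add1n exprS.
  rewrite (@eq_Ex' s (fun E => (C \subset E)%:R) (fun=> 0)).
    by rewrite Ex_const mulr0 addr0.
  move=> E Es; case: subsetP => // CE.
  by have := CE _ aC => /(subsetP Es); rewrite (negPf as_).
have CC : C :\ a = C by apply/setDidPl; rewrite disjoint_sym disjoints1.
have Cs2 : C \subset s by rewrite -CC.
by rewrite CC (IH _ us Cs2); ring.
Qed.

Lemma Ex_draw s f : uniq s ->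
  Ex s f = \sum_(E : {set T} | E \subset s)
             p ^+ #|E| * (1 - p) ^+ (size s - #|E|) * f E.
Proof.
elim: s f => [|a s IH] f /=.
  move=> _; rewrite (big_pred1 set0) => [|E]; first by rewrite cards0 !expr0 !mul1r.
  apply/subsetP/eqP => [E0|-> x]; last by rewrite inE.
  by apply/setP => x; rewrite inE; apply/negP => /E0.
move=> /andP[as_ us]; rewrite !IH // [RHS](bigID (fun E : {set T} => a \in E)) /=.
have sE (E : {set T}) : E \subset s -> (#|E| <= size s)%N.
  by move=> /subset_leq_card /leq_trans; apply; apply: card_size.
congr (_ + _); rewrite mulr_sumr.
  rewrite [RHS](reindex_onto (fun E => a |: E) (fun E => E :\ a)) /=; last first.
    by move=> E /andP[_ aE]; rewrite setD1K.
  apply: eq_big => [E|E Es].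
    apply/idP/idP => [/subsetP Es|/andP[/andP[/subsetP Es _] /eqP <-]].
      have aE : a \notin E by apply: contra as_ => /Es.
      rewrite setU1K // eqxx andbT setU11 andbT.
      by apply/subsetP => x; rewrite !inE => /orP[->//|/Es ->]; rewrite orbT.
    by apply/subsetP => x; rewrite !inE => /andP[xa]; rewrite (negPf xa) /= => xE;
      have := Es x; rewrite !inE xE (negPf xa) orbT => /(_ isT).
  have aE : a \notin E by apply: contra as_; apply/subsetP: a.
  by rewrite cardsU1 aE add1n subSS exprS; ring.
apply: eq_big => [E|E Es]; last by rewrite subSn ?sE // exprS; ring.
apply/idP/andP => [/subsetP Es|[/subsetP Es aE]].
  split; last by apply: contra as_ => /Es.
  by apply/subsetP => x /Es; rewrite inE orbC => ->.
apply/subsetP => x xE; have := Es x xE; rewrite inE => /orP[/eqP xa|//].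
by rewrite -xa xE in aE.
Qed.

Section Events.
Variable s : seq T.
Hypothesis us : uniq s.
Implicit Types A B : {set T} -> bool.

Definition pr (A : {set T} -> bool) : R := Ex s (fun E => (A E)%:R).

Lemma pr_ge0 A : 0 <= pr A.
Proof. by rewrite -[0](Ex_const s); apply: le_Ex => E; rewrite ler0n. Qed.

Lemma pr_le A B : (forall E, A E -> B E) -> pr A <= pr B.
Proof.
move=> AB; apply: le_Ex => E; have := AB E.
by case: (A E) => [->//|_]; rewrite ler0n.
Qed.

Lemma pr_compl A : pr (fun E => ~~ A E) = 1 - pr A.
Proof.
rewrite -[1 in RHS](Ex_const s) -ExB; apply: eq_Ex => E.
by case: (A E); rewrite ?subrr ?subr0.
Qed.

Lemma pr_union_bound (I : eqType) (r : seq I) (B : I -> {set T} -> bool)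
    (A : {set T} -> bool) :
  (forall E, A E -> has (B^~ E) r) -> pr A <= \sum_(i <- r) pr (B i).
Proof.
move=> AB; rewrite /pr -Ex_sum; apply: le_Ex => E.
have : ((A E)%:R : R) <= (has (B^~ E) r)%:R.
  by have := AB E; case: (A E) => [->//|_]; rewrite ler0n.
move/le_trans; apply; elim: r {AB} => [|i r IH] /=; first by rewrite big_nil.
rewrite big_cons; case: (B i E) => /=; last by rewrite add0r.
by rewrite lerDl sumr_ge0 // => j _; rewrite ler0n.
Qed.

Definition none_of (cs : seq {set T}) E := all (fun C => ~~ (C \subset E)) cs.

Lemma none_of_decr cs E a : none_of cs (a |: E) -> none_of cs E.
Proof.
move=> /allP h; apply/allP => C Ccs; apply: contra (h _ Ccs) => /subset_trans.
by apply; apply: subsetUr.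
Qed.

Lemma pr_sub_none_of C cs : C \subset s ->
  pr (fun E => (C \subset E) && none_of cs E) <= p ^+ #|C| * pr (none_of cs).
Proof.
move=> Cs; rewrite -(Ex_sub us Cs) /pr.
under eq_Ex do rewrite -mulnb natrM.
apply: harris => E a.
  case CE : (C \subset E); last by rewrite ler0n.
  by rewrite (subset_trans CE) // subsetUr.
have := @none_of_decr cs E a.
by case: (none_of cs (a |: E)) => [->//|_]; rewrite ler0n.
Qed.

(** Presence of [C] and avoidance of [cs] are negatively correlated by Harris' inequality, so each
    set costs at most a factor 1 - p^|C|. *)
Lemma prod_le_pr_none_of cs : all (fun C : {set T} => C \subset s) cs ->
  \prod_(C <- cs) (1 - p ^+ #|C|) <= pr (none_of cs).
Proof.
elim: cs => [_|C cs IH] /=; first by rewrite big_nil /pr Ex_const.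
move=> /andP[Cs css]; rewrite big_cons.
have pC : 0 <= 1 - p ^+ #|C| by rewrite subr_ge0 exprn_ile1.
apply: le_trans (ler_wpM2l pC (IH css)) _.
have -> : pr (none_of (C :: cs)) =
    pr (none_of cs) - pr (fun E => (C \subset E) && none_of cs E).
  rewrite /pr -ExB; apply: eq_Ex => E /=.
  by case: (C \subset E) (none_of cs E) => [] []; rewrite ?subrr ?subr0.
by rewrite mulrBl mul1r lerB // pr_sub_none_of.
Qed.

(* The Boppana-Spencer argument, written without conditional probabilities:
   [D] collects the sets of [cs] disjoint from [C] and is independent of [C]. *)
Lemma pr_none_of_cons_le C cs : C \subset s ->
  all (fun C : {set T} => C \subset s) cs ->
  pr (none_of (C :: cs)) <= pr (none_of cs) *
    (1 - (p ^+ #|C| - \sum_(C' <- cs | ~~ [disjoint C & C']) p ^+ #|C :|: C'|)).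
Proof.
move=> Cs css.
set D := [seq C' : {set T} <- cs | [disjoint C & C']].
set delta := \sum_(C' <- cs | _) _.
have -> : pr (none_of (C :: cs)) =
    pr (none_of cs) - pr (fun E => (C \subset E) && none_of cs E).
  rewrite /pr -ExB; apply: eq_Ex => E /=.
  by case: (C \subset E) (none_of cs E) => [] []; rewrite ?subrr ?subr0.
rewrite mulrBr mulr1 lerB //.
have [le0|gt0] := leP (p ^+ #|C| - delta) 0.
  by apply: le_trans (pr_ge0 _); rewrite mulr_ge0_le0 // pr_ge0.
have AD : pr (none_of cs) <= pr (none_of D).
  apply: pr_le => E /allP h; apply/allP => C'; rewrite mem_filter => /andP[_].
  exact: h.
apply: le_trans (ler_wpM2r (ltW gt0) AD) _.
have indep : pr (fun E => (C \subset E) && none_of D E) =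
    p ^+ #|C| * pr (none_of D).
  rewrite -(Ex_sub us Cs) /pr -Ex_indep.
    by apply: eq_Ex => E; rewrite -mulnb natrM.
  move=> a _; have [aC|aC] := boolP (a \in C); [right|left] => E.
    congr (_%:R); congr (nat_of_bool _); apply: eq_in_all => C'.
    rewrite mem_filter => /andP[CC' _]; congr (~~ _).
    rewrite -subDset (_ : C' :\ a = C') //.
    by apply/setDidPl; rewrite disjoint_sym disjoints1 (disjointFr CC').
  rewrite -subDset (_ : C :\ a = C) //.
  by apply/setDidPl; rewrite disjoint_sym disjoints1.
rewrite mulrC mulrBl -indep lerBlDr.
rewrite (_ : delta * _ = \sum_(C' <- cs | ~~ [disjoint C & C'])
   p ^+ #|C :|: C'| * pr (none_of D)); last by rewrite mulr_suml.
(* If [C] is present and [D] is avoided, either all of [cs] is avoided or some set meeting [C] is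
   present as well. *)
apply: le_trans (_ : pr (fun E => (C \subset E) && none_of cs E) +
  \sum_(C' <- cs | ~~ [disjoint C & C'])
    pr (fun E => (C :|: C' \subset E) && none_of D E) <= _); last first.
  rewrite lerD2l big_seq_cond [leRHS]big_seq_cond; apply: ler_sum => C' /andP[C'cs _].
  apply: pr_sub_none_of; apply/subsetP => z /setUP[]; first exact: (subsetP Cs).
  by have := allP css _ C'cs => /subsetP; apply.
rewrite /pr -Ex_sum -ExD; apply: le_Ex => E.
case CE : (C \subset E) => /=; last first.
  by rewrite add0r sumr_ge0 // => C' _; rewrite ler0n.
case DE : (none_of D E) => /=; last first.
  by rewrite addr_ge0 ?ler0n // sumr_ge0 // => C' _; rewrite ler0n.
case: (boolP (none_of cs E)) => [h|]; rewrite /= ?mulr1n.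
  by rewrite lerDl sumr_ge0 // => C' _; rewrite ler0n.
rewrite add0r => /allPn[C' C'cs]; rewrite negbK => C'E.
have nd : ~~ [disjoint C & C'].
  apply/negP => d; move/allP: DE => /(_ C').
  by rewrite mem_filter d C'cs C'E => /(_ isT).
rewrite (big_rem C') //= nd subUset CE C'E /=.
by rewrite lerDl sumr_ge0 // => C'' _; rewrite ler0n.
Qed.

(** The one-set bounds are multiplied using 1 - x <= exp(-x). The induction produces each
    overlapping pair once; the stated sum has it in both orders, which is harmless for an error
    term. *)
Theorem janson_le cs : uniq cs -> all (fun C : {set T} => C \subset s) cs ->
  pr (none_of cs) <= expR (- (\sum_(C <- cs) p ^+ #|C|) +
    \sum_(C <- cs) \sum_(C' <- cs | (C' != C) && ~~ [disjoint C & C'])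
       p ^+ #|C :|: C'|).
Proof.
elim: cs => [_ _|C cs IH] /=.
  by rewrite !big_nil oppr0 addr0 expR0 /pr Ex_const.
move=> /andP[Ccs ucs] /andP[Cs css].
apply: le_trans (pr_none_of_cons_le Cs css) _.
set e := (X in 1 - X).
apply: le_trans (_ : pr (none_of cs) * expR (- e) <= _).
  by apply: ler_wpM2l; [apply: pr_ge0|apply: expR_ge1Dx].
apply: le_trans (ler_wpM2r (expR_ge0 _) (IH ucs css)) _.
rewrite -expRD ler_expR !big_cons eqxx /= /e.
set S1 := \sum_(C' <- cs) p ^+ #|C'|.
set S2 := \sum_(C0 <- cs) _.
set d := \sum_(C' <- cs | ~~ _) _.
set d' := \sum_(C' <- cs | _ && _) _.
set S3 := \sum_(C0 <- cs) _.
have -> : d = d'.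
  rewrite /d /d' big_seq_cond [RHS]big_seq_cond; apply: eq_bigl => C'.
  case C'cs : (C' \in cs) => //=; case: eqP => // CC'.
  by rewrite CC' (negPf Ccs) in C'cs.
have : S2 <= S3.
  apply: ler_sum => C' _; rewrite big_cons; case: ifP => // _.
  by rewrite lerDr exprn_ge0.
lra.
Qed.

End Events.
End RandomSubset.

(** * Cycles of the random graph *)

Lemma gnp_probE (R : realType) (p : R) n (P : rel 'I_n -> Prop) :
  gnp_prob p P = pr p (enum (pairs n)) (fun E => `[< P (graph_of E) >]).
Proof.
rewrite /pr Ex_draw ?enum_uniq // /gnp_prob.
have sub E : (E \subset enum (pairs n)) = (E \subset pairs n).
  by apply: eq_subset_r => x; rewrite mem_enum.
under [RHS]eq_bigl do rewrite sub.
rewrite [RHS](bigID (fun E => `[< P (graph_of E) >])) /=.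
rewrite [X in _ = _ + X]big1 ?addr0 => [|E /andP[_ /negPf->]]; last by rewrite mulr0.
by apply: eq_bigr => E /andP[_ ->]; rewrite mulr1 /gnp_weight -cardE.
Qed.

Lemma set2_eq (T : finType) (a b c d : T) : [set a; b] = [set c; d] ->
  (a = c /\ b = d) \/ (a = d /\ b = c).
Proof.
move=> e; 
have := set21 c d; have := set22 c d; rewrite -e => /set2P da /set2P cb.
have {}ac : a = c \/ a = d by apply/set2P; rewrite -e set21.
have {}bd : b = c \/ b = d by apply/set2P; rewrite -e set22.
by case: ac bd da cb => ? [] ? [] ? [] ?; subst; auto.
Qed.

(** * Arithmetic of cyclic indices *)

Section Zk.
Variable m : nat.
Implicit Types i j : 'I_m.+3.

Lemma Zk_addr1_neq i : i + 1 != i.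
Proof. by rewrite -subr_eq0 addrAC subrr add0r. Qed.

Lemma Zk_2_neq0 : (1 + 1 : 'I_m.+3) != 0.
Proof. by rewrite -mulr2n Zp_nat. Qed.

Lemma Zk_addr11_neq i : i + 1 + 1 != i.
Proof. by rewrite -subr_eq0 -[X in X - _]addrA addrAC subrr add0r Zk_2_neq0. Qed.

Lemma Zk_addr1_neq_sub1 i : i + 1 != i - 1.
Proof. by rewrite eq_sym subr_eq eq_sym Zk_addr11_neq. Qed.

Lemma Zk_ind (P : 'I_m.+3 -> Prop) i :
  P i -> (forall j, P j -> P (j + 1)) -> forall j, P j.
Proof.
move=> Pi PS j; rewrite -(subrK i j) addrC.
rewrite -[(j - i)%R]natr_Zp.
elim: (nat_of_ord _) => [|k IH]; first by rewrite addr0.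
by rewrite -natr1 addrA; apply: PS.
Qed.

End Zk.

Section Cycles.
Variable n : nat.

(** A cycle of length k >= 3 is an injective map on ['I_m.+3] with k = m + 3, so that indices add
    modulo k. Its edge set forgets starting point and direction. *)
Definition cyc_edges m (x : {ffun 'I_m.+3 -> 'I_n}) : {set {set 'I_n}} :=
  [set [set x i; x (i + 1)] | i : 'I_m.+3].

Lemma cyc_edge_inj m (x : {ffun 'I_m.+3 -> 'I_n}) : injective x ->
  injective (fun i => [set x i; x (i + 1)]).
Proof.
move=> xI i j /set2_eq[[/xI]//|[/xI ij /xI ji]].
by have := Zk_addr11_neq j; rewrite -ij ji eqxx.
Qed.

Lemma card_cyc_edges m (x : {ffun 'I_m.+3 -> 'I_n}) : injective x ->
  #|cyc_edges x| = m.+3.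
Proof. by move=> /cyc_edge_inj xI; rewrite card_imset // card_ord. Qed.

Lemma cyc_edges_sub m (x : {ffun 'I_m.+3 -> 'I_n}) : injective x ->
  cyc_edges x \subset pairs n.
Proof.
move=> xI; apply/subsetP => _ /imsetP[i _ ->]; rewrite inE cards2.
by rewrite (inj_eq xI) [i == _]eq_sym Zk_addr1_neq.
Qed.

(** Every edge of [y] is an edge of [x], so [y] is a walk on the indices of [x] with steps +1 and
    -1. *)
Lemma cyc_edges_lift l m (y : {ffun 'I_l.+3 -> 'I_n}) (x : {ffun 'I_m.+3 -> 'I_n}) :
  injective x -> cyc_edges y \subset cyc_edges x ->
  exists sg : 'I_l.+3 -> 'I_m.+3, (forall i, y i = x (sg i)) /\
    (forall i, sg (i + 1) = sg i + 1 \/ sg i = sg (i + 1) + 1).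
Proof.
move=> xI /subsetP yx.
have H i : exists j, ([set y i; y (i + 1)] == [set x j; x (j + 1)]).
  have /yx/imsetP[j _ ->] : [set y i; y (i + 1)] \in cyc_edges y by apply: imset_f.
  by exists j.
have /boolp.choice[sg ysg] i : exists j, y i = x j.
  by have [j /eqP/set2_eq[[-> _]|[-> _]]] := H i; [exists j|exists (j + 1)].
exists sg; split=> // i.
have [j /eqP/set2_eq[]] := H i; rewrite !ysg => -[/xI -> /xI ->]; first by left.
by right.
Qed.

Lemma cyc_edges_lift_inj l m (y : {ffun 'I_l.+3 -> 'I_n}) (x : {ffun 'I_m.+3 -> 'I_n})
    (sg : 'I_l.+3 -> 'I_m.+3) :
  injective y -> (forall i, y i = x (sg i)) -> injective sg.
Proof. by move=> yI ysg i j sij; apply: yI; rewrite !ysg sij. Qed.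

(** An injective walk sends the two neighbours of an index to two different neighbours, so its image
    is closed under successor and is the whole of [x]. *)
Lemma cyc_edges_sub_eq l m (y : {ffun 'I_l.+3 -> 'I_n}) (x : {ffun 'I_m.+3 -> 'I_n}) :
  injective x -> injective y -> cyc_edges y \subset cyc_edges x ->
  cyc_edges y = cyc_edges x.
Proof.
move=> xI yI yx; have [sg [ysg sg1]] := cyc_edges_lift xI yx.
have sgI := cyc_edges_lift_inj yI ysg.
have sgS j : exists i, sg i = j.
  apply: (@Zk_ind _ (fun j => exists i, sg i = j) (sg 0)) => [|_ [i <-]].
    by exists 0.
  have [e|e] := sg1 i; first by exists (i + 1).
  have := sg1 (i - 1); rewrite subrK => -[e'|<-]; last by exists (i - 1).
  move: e'; rewrite e => /addIr/sgI/eqP.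
  by rewrite (negPf (Zk_addr1_neq_sub1 _)).
apply/eqP; rewrite eqEcard yx !card_cyc_edges //.
have : (#|'I_m.+3| <= #|'I_l.+3|)%N.
  rewrite -(card_codom sgI); apply: subset_leq_card; apply/subsetP => j _.
  by have [i <-] := sgS j; apply: codom_f.
by rewrite !card_ord.
Qed.

Section Fiber.
Variable m : nat.
Implicit Types x y : {ffun 'I_m.+3 -> 'I_n}.

Definition dihedral x (rb : 'I_m.+3 * bool) : {ffun 'I_m.+3 -> 'I_n} :=
  [ffun i => x (if rb.2 then rb.1 + i else rb.1 - i)].

Lemma dihedral_inj x : injective x -> injective (dihedral x).
Proof.
move=> xI [r b] [r' b'] /ffunP e; have := e 0; have := e 1.
rewrite !ffunE /= !addr0 !subr0.
have -> : (if b then r else r) = r by case: b {e}.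
have -> : (if b' then r' else r') = r' by case: b' {e}.
move=> /xI e1 /xI rr'; rewrite rr' in e1 *.
by case: b b' {e} e1 => [] [] // /eqP; rewrite ?(negPf (Zk_addr1_neq_sub1 _)) // eq_sym (negPf (Zk_addr1_neq_sub1 _)).
Qed.

Lemma dihedral_injective x rb : injective x -> injective (dihedral x rb).
Proof.
case: rb => r b xI i j; rewrite !ffunE /= => /xI.
by case: b => [/addrI//|/addrI/oppr_inj].
Qed.

Lemma cyc_edges_dihedral x rb : injective x ->
  cyc_edges (dihedral x rb) = cyc_edges x.
Proof.
move=> xI; apply: cyc_edges_sub_eq => //; first exact: dihedral_injective.
apply/subsetP => _ /imsetP[i _ ->]; rewrite !ffunE; case: rb => r [] /=.
  by rewrite addrA (imset_f (fun i => [set x i; x (i + 1)])).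
rewrite setUC -[X in [set _; x X]](subrK 1) opprD addrA.
by rewrite (imset_f (fun i => [set x i; x (i + 1)])).
Qed.

(** The first step fixes a direction, and injectivity forbids turning back: the lift is a rotation
    or a reflection. *)
Lemma cyc_edges_eqP x y : injective x -> injective y ->
  cyc_edges y = cyc_edges x -> exists rb, y = dihedral x rb.
Proof.
move=> xI yI yx.
have [|sg [ysg sg1]] := @cyc_edges_lift _ _ y x xI; first by rewrite yx.
have sgI := cyc_edges_lift_inj yI ysg.
have [s01|s01] := sg1 0.
  exists (sg 0, true); apply/ffunP => i; rewrite ffunE /= ysg; congr (x _).
  suff : sg i = sg 0 + i /\ sg (i + 1) = sg i + 1 by case.
  apply: (@Zk_ind _ (fun i => sg i = sg 0 + i /\ sg (i + 1) = sg i + 1) 0) => [|{}i].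
    by rewrite addr0.
  move=> [si si1]; rewrite si1 si addrA; split=> //.
  have [->|e] := sg1 (i + 1); first by rewrite si1 si.
  by have := Zk_addr11_neq i; move: e; rewrite si1 => /addIr/sgI <-; rewrite eqxx.
exists (sg 0, false); apply/ffunP => i; rewrite ffunE /= ysg; congr (x _).
suff : sg i = sg 0 - i /\ sg (i + 1) = sg i - 1 by case.
apply: (@Zk_ind _ (fun i => sg i = sg 0 - i /\ sg (i + 1) = sg i - 1) 0) => [|{}i].
  by rewrite subr0 s01 addrK.
move=> [si si1]; rewrite si1 si opprD addrA; split=> //.
have [e|e] := sg1 (i + 1); last by rewrite -si -si1 e addrK.
by have := Zk_addr11_neq i; move: e; rewrite si1 subrK => /sgI ->; rewrite eqxx.
Qed.

Definition inj_ffuns : {set {ffun 'I_m.+3 -> 'I_n}} := [set x : {ffun 'I_m.+3 -> 'I_n} | injectiveb x].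

Definition cycles : {set {set {set 'I_n}}} := [set cyc_edges x | x in inj_ffuns].

Lemma cyclesP C : reflect (exists2 x : {ffun 'I_m.+3 -> 'I_n}, injective x & C = cyc_edges x)
  (C \in cycles).
Proof.
apply: (iffP imsetP) => -[x]; rewrite ?inE; first by move=> /injectiveP; exists x.
by exists x => //; rewrite inE; apply/injectiveP.
Qed.

(** The injective maps with a given edge set form one orbit of the dihedral group, of size 2k. *)
Lemma card_cycles : (#|cycles| * (2 * m.+3) = n ^_ m.+3)%N.
Proof.
have <- : #|inj_ffuns| = (n ^_ m.+3)%N by rewrite card_inj_ffuns !card_ord.
rewrite -[RHS]sum1_card (partition_big_imset (@cyc_edges m)) /=.
rewrite -/cycles -sum_nat_const; apply: eq_bigr => _ /cyclesP[x xI ->].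
rewrite sum1dep_card.
have -> : [set y | (y \in inj_ffuns) && (cyc_edges y == cyc_edges x)] =
          [set dihedral x rb | rb in [set: 'I_m.+3 * bool]].
  apply/setP => y; rewrite !inE; apply/andP/imsetP => [[/injectiveP yI /eqP yx]|].
    by have [rb ->] := cyc_edges_eqP xI yI yx; exists rb.
  move=> [rb _ ->]; split; first by apply/injectiveP; apply: dihedral_injective.
  by rewrite cyc_edges_dihedral.
rewrite card_imset; last exact: dihedral_inj.
by rewrite cardsT card_prod card_ord card_bool mulnC.
Qed.

End Fiber.

(** The union of two distinct overlapping cycles has more edges than vertices. Both edges of [y] at
    a vertex off [x] are off [x]. If there were no more edges off [x] than such vertices, these
    edges would be closed under predecessor; as some edge is shared, there would be none, and the
    cycles would agree. *)
Lemma card_cyc_edgesU l m (x : {ffun 'I_m.+3 -> 'I_n}) (y : {ffun 'I_l.+3 -> 'I_n}) :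
  injective x -> injective y -> cyc_edges y != cyc_edges x ->
  ~~ [disjoint cyc_edges x & cyc_edges y] ->
  (m.+3 + #|[set i | y i \notin codom x]| < #|cyc_edges x :|: cyc_edges y|)%N.
Proof.
move=> xI yI yx ndis; rewrite cardsU card_cyc_edges //.
set U := [set i | _].
set N := [set i | [set y i; y (i + 1)] \notin cyc_edges x].
have cN : (#|cyc_edges y :\: cyc_edges x| = #|N|)%N.
  rewrite -(card_imset _ (cyc_edge_inj yI)); apply: eq_card => e.
  rewrite !inE; apply/andP/imsetP => [[ex /imsetP[i _ ei]]|[i + ->]].
    by exists i => //; rewrite inE -ei.
  by rewrite inE => ->; split => //; apply: imset_f.
have := cardsID (cyc_edges x) (cyc_edges y); rewrite cN setIC => <-.
suff : (#|U| < #|N|)%N by lia.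
have UN i : i \in U -> i \in N /\ i - 1 \in N.
  rewrite !inE => yi; split; apply: contra yi => /imsetP[j _ /set2_eq].
    by move=> [[-> _]|[-> _]]; apply: codom_f.
  by rewrite subrK => -[[_ ->]|[_ ->]]; apply: codom_f.
have sUN : U \subset N by apply/subsetP => i /UN[].
rewrite ltn_neqAle subset_leq_card // andbT; apply/negP => /eqP cUN.
have eUN : U = N by apply/eqP; rewrite eqEcard sUN cUN leqnn.
have [i iN] : exists i, i \notin N.
  move: ndis => /pred0Pn[e /andP[/= ex /imsetP[i _ ei]]].
  by exists i; rewrite inE negbK -ei.
have N0 j : j \notin N.
  apply: (Zk_ind (P := fun j => j \notin N) iN) => {}j; apply: contra; rewrite -eUN => /UN[_].
  by rewrite addrK eUN.
case/eqP: yx; apply: cyc_edges_sub_eq => //.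
apply/subsetP => _ /imsetP[j _ ->]; have := N0 j.
by rewrite inE negbK.
Qed.

End Cycles.

Lemma ler_sum_imset (R : realDomainType) (I J : finType) (h : I -> J)
    (A : {set I}) (F : J -> R) : (forall j, 0 <= F j) ->
  \sum_(j in h @: A) F j <= \sum_(i in A) F (h i).
Proof.
move=> F0; rewrite (partition_big_imset h) /=.
apply: ler_sum => j /imsetP[i Ai ->]; rewrite (bigD1 i) /=; last by rewrite Ai /=.
by rewrite lerDl sumr_ge0.
Qed.

Lemma ffact_le_expn n k : (n ^_ k <= n ^ k)%N.
Proof.
elim: k => [//|k IH]; rewrite ffactnSr expnSr leq_mul // leq_subr //.
Qed.

(** * Expected numbers of cycles and of overlapping pairs *)

Section CycleExpectation.
Variables (R : realType) (c : R) (n : nat).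
Hypotheses (c0 : 0 <= c) (c1 : c < 1) (n0 : (0 < n)%N).
Let p : R := c / n%:R.

Let n0R : 0 < n%:R :> R. Proof. by rewrite ltr0n. Qed.

Lemma edge_prob_ge0 : 0 <= p. Proof. by rewrite divr_ge0. Qed.

Lemma edge_prob_leV : p <= n%:R^-1.
Proof. by rewrite /p ler_piMl ?invr_ge0 // ltW. Qed.

Lemma edge_prob_lt1 : p < 1.
Proof.
rewrite /p ltr_pdivrMr // mul1r (lt_le_trans c1) //.
by rewrite ler1n.
Qed.

Let p0 := edge_prob_ge0.
Let p1 : p <= 1. Proof. exact: ltW edge_prob_lt1. Qed.

(** One more factor multiplies the ratio by at least 1 - k/n, and k^2 + k <= (k+1)^2. *)
Lemma natr_ffact_ge k : n%:R ^+ k * (1 - (k ^ 2)%:R / n%:R) <= (n ^_ k)%:R :> R.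
Proof.
suff : 1 - (k ^ 2)%:R / n%:R <= (n ^_ k)%:R / n%:R ^+ k :> R.
  by rewrite ler_pdivlMr ?exprn_gt0 // mulrC.
elim: k => [|k IH]; first by rewrite ffactn0 expr0 mul0r subr0 divr1.
rewrite ffactnSr exprSr natrM invfM mulrACA.
set F := (n ^_ k)%:R / n%:R ^+ k in IH *.
have F0 : 0 <= F by rewrite divr_ge0 // exprn_ge0.
have F1 : F <= 1.
  by rewrite /F ler_pdivrMr ?exprn_gt0 // mul1r -natrX ler_nat ffact_le_expn.
have nk : 1 - k%:R / n%:R <= (n - k)%N%:R / n%:R :> R.
  rewrite -[X in X - _](@divff _ n%:R) ?gt_eqF // -mulrBl.
  rewrite ler_pM2r ?invr_gt0 // lerBlDr -natrD ler_nat.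
  by rewrite addnC -leq_subLR.
apply: le_trans (ler_wpM2l F0 nk).
set x := n%:R^-1 in IH nk *.
have x0 : 0 <= x by rewrite invr_ge0.
have kx : 0 <= k%:R * x :> R by rewrite mulr_ge0.
have := ler_wpM2r kx F1.
move: IH; rewrite !natrX -natr1.
move: (F * _) => z; nra.
Qed.

(** The limit of the expected number of cycles of length m + 3. *)
Definition cycle_weight m : R := c ^+ m.+3 / (2 * m.+3)%:R.

Lemma cycle_weight_ge0 m : 0 <= cycle_weight m.
Proof. by rewrite divr_ge0 // exprn_ge0. Qed.

Lemma expected_cyclesE m : \sum_(C in cycles n m) p ^+ #|C| =
  (n ^_ m.+3)%:R / n%:R ^+ m.+3 * cycle_weight m.
Proof.
rewrite (eq_bigr (fun=> p ^+ m.+3)) => [|C /cyclesP[x xI ->]]; last first.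
  by rewrite card_cyc_edges.
rewrite sumr_const -mulr_natl -card_cycles natrM /cycle_weight /p expr_div_n.
by field; rewrite expf_neq0 ?gt_eqF //= -natr1; move: (ler0n R m); lra.
Qed.

Lemma expected_cycles_le m : \sum_(C in cycles n m) p ^+ #|C| <= cycle_weight m.
Proof.
rewrite expected_cyclesE ler_piMl ?cycle_weight_ge0 //.
by rewrite ler_pdivrMr ?exprn_gt0 // mul1r -natrX ler_nat ffact_le_expn.
Qed.

Lemma expected_cycles_ge m :
  cycle_weight m - (m.+3 ^ 2)%:R / n%:R <= \sum_(C in cycles n m) p ^+ #|C|.
Proof.
rewrite expected_cyclesE.
have w0 := cycle_weight_ge0 m.
have w1 : cycle_weight m <= 1.
  rewrite ler_pdivrMr ?ltr0n // mul1r (@le_trans _ _ 1) ?ler1n //.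
  by rewrite exprn_ile1 // ltW.
have h : 1 - (m.+3 ^ 2)%:R / n%:R <= (n ^_ m.+3)%:R / n%:R ^+ m.+3 :> R.
  by rewrite ler_pdivlMr ?exprn_gt0 // mulrC natr_ffact_ge.
apply: le_trans (ler_wpM2r w0 h); rewrite mulrBl mul1r lerB //.
by rewrite ler_piMr // divr_ge0.
Qed.

(** The union has more edges than vertices and each edge has probability at most 1/n, which leaves a
    factor 1/n. For fixed [x], each of the l + 3 vertices of [y] contributes at most m + 3 for
    positions on [x] and 1 for all others, hence the base m + 4. *)
Lemma overlapping_cycles_le m l :
  \sum_(C in cycles n m)
     \sum_(C' in cycles n l | (C' != C) && ~~ [disjoint C & C']) p ^+ #|C :|: C'|
  <= (m.+4 ^ l.+3)%:R / n%:R.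
Proof.
have pX k : 0 <= p ^+ k by rewrite exprn_ge0.
apply: le_trans (ler_sum_imset _ _ _) _ => [C|].
  by rewrite sumr_ge0.
have -> : (m.+4 ^ l.+3)%:R / n%:R =
    n%:R ^+ m.+3 * (n%:R^-1 ^+ m.+3 * ((m.+4 ^ l.+3)%:R / n%:R)) :> R.
  by rewrite mulrA -exprMn divff ?gt_eqF // expr1n mul1r.
have cA : (#|inj_ffuns n m|%:R <= n%:R ^+ m.+3 :> R).
  by rewrite card_inj_ffuns !card_ord -natrX ler_nat ffact_le_expn.
have nV0 : 0 <= n%:R^-1 :> R by rewrite invr_ge0.
have h0 : 0 <= n%:R^-1 ^+ m.+3 * ((m.+4 ^ l.+3)%:R / n%:R) :> R.
  by rewrite mulr_ge0 ?exprn_ge0 ?divr_ge0.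
apply: le_trans (ler_wpM2r h0 cA).
rewrite [leRHS]mulr_natl -sumr_const.
apply: ler_sum => x; rewrite inE => /injectiveP xI.
rewrite big_mkcondr; apply: le_trans (ler_sum_imset _ _ _) _ => [C|].
  by case: ifP.
(* Each vertex of [y] off [x] costs a factor 1/n, so the sum over [y] factorizes. *)
pose w z : R := if z \in codom x then 1 else n%:R^-1.
have w0 z : 0 <= w z by rewrite /w; case: ifP; rewrite ?invr_ge0.
apply: (@le_trans _ _ (\sum_(y : {ffun 'I_l.+3 -> 'I_n})
   n%:R^-1 ^+ m.+3 * n%:R^-1 * \prod_i w (y i))).
  rewrite big_mkcond /=; apply: ler_sum => y _.
  have r0 : 0 <= n%:R^-1 ^+ m.+3 * n%:R^-1 * \prod_i w (y i).
    by apply: mulr_ge0; [rewrite mulr_ge0 ?exprn_ge0|apply: prodr_ge0].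
  case: ifP => // yI; case: ifP => // /andP[yx ndis].
  rewrite inE in yI; move/injectiveP : yI => yI.
  have -> : \prod_i w (y i) = n%:R^-1 ^+ #|[set i | y i \notin codom x]|.
    rewrite -prodr_const [RHS]big_mkcond; apply: eq_bigr => i _.
    by rewrite inE /w; case: ifP.
  rewrite -exprSr -exprD addSn.
  have nV1 : n%:R^-1 <= 1 :> R by rewrite invf_le1 // ler1n.
  apply: le_trans (_ : n%:R^-1 ^+ #|cyc_edges x :|: cyc_edges y| <= _).
    by apply: lerXn2r; rewrite ?nnegrE // edge_prob_leV.
  by apply: ler_wiXn2l => //; apply: card_cyc_edgesU.
rewrite -mulr_sumr -mulrA ler_wpM2l ?exprn_ge0 // mulrC ler_wpM2r //.
rewrite -(bigA_distr_bigA (fun _ : 'I_l.+3 => w)) prodr_const card_ord natrX.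
apply: lerXn2r; rewrite ?nnegrE ?sumr_ge0 //.
rewrite (bigID (fun z => z \in codom x)) /= -natr1; apply: lerD.
  rewrite (eq_bigr (fun=> 1)) => [|z zx]; last by rewrite /w zx.
  by rewrite sumr_const ler_nat -[leqRHS](card_ord m.+3) card_codom.
rewrite (eq_bigr (fun=> n%:R^-1)) => [|z zx]; last by rewrite /w (negPf zx).
rewrite sumr_const -[_ *+ #|_|]mulr_natl ler_pdivrMr // mul1r ler_nat.
by rewrite -[leqRHS]card_ord max_card.
Qed.

Section Families.
Variable ms : seq nat.
Hypotheses (ums : uniq ms).

Definition cycle_family : seq {set {set 'I_n}} :=
  flatten [seq enum (cycles n m) | m <- ms].

Lemma mem_cycle_family C :
  (C \in cycle_family) = has (fun m => C \in cycles n m) ms.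
Proof.
apply/flatten_mapP/hasP => -[m mms]; rewrite ?mem_enum => Cm; exists m => //.
by rewrite mem_enum.
Qed.

Lemma big_cycle_family (P : pred {set {set 'I_n}}) F :
  \sum_(C <- cycle_family | P C) F C =
  \sum_(m <- ms) \sum_(C in cycles n m | P C) F C :> R.
Proof.
by rewrite big_flatten big_map; apply: eq_bigr => m _; rewrite big_enum_cond.
Qed.

Lemma uniq_cycle_family : uniq cycle_family.
Proof.
rewrite /cycle_family; elim: ms ums => //= m r IH /andP[mr ur].
rewrite cat_uniq enum_uniq IH // andbT; apply/hasPn => C.
move=> /flatten_mapP[l lr]; rewrite !mem_enum => /cyclesP[x xI ->].
apply/negP => /cyclesP[y yI e].
have := card_cyc_edges xI; rewrite e card_cyc_edges // => -[ml].
by rewrite ml lr in mr.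
Qed.

Lemma cycle_family_sub :
  all (fun C : {set {set 'I_n}} => C \subset enum (pairs n)) cycle_family.
Proof.
apply/allP => C; rewrite mem_cycle_family => /hasP[m _ /cyclesP[x xI ->]].
apply/subsetP => e ex; rewrite mem_enum.
exact: (subsetP (cyc_edges_sub xI)).
Qed.

Definition overlap_bound : R :=
  \sum_(m <- ms) (m.+3 ^ 2)%:R + \sum_(m <- ms) \sum_(l <- ms) (m.+4 ^ l.+3)%:R.

Lemma pr_no_cycle_le : pr p (enum (pairs n)) (none_of cycle_family) <=
  expR (- \sum_(m <- ms) cycle_weight m + overlap_bound / n%:R).
Proof.
apply: le_trans (janson_le p0 p1 (enum_uniq _) uniq_cycle_family cycle_family_sub) _.
rewrite ler_expR /overlap_bound mulrDl addrA; apply: lerD.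
  suff : \sum_(m <- ms) cycle_weight m - (\sum_(m <- ms) (m.+3 ^ 2)%:R) / n%:R
      <= \sum_(C <- cycle_family) p ^+ #|C| by lra.
  rewrite big_cycle_family mulr_suml -sumrB.
  by apply: ler_sum => m _; rewrite (eq_bigl _ _ (fun C => andbT _)) expected_cycles_ge.
rewrite big_cycle_family mulr_suml; apply: ler_sum => m _.
rewrite (eq_bigl _ _ (fun C => andbT _)).
under eq_bigr do rewrite big_cycle_family.
rewrite exchange_big /= mulr_suml; apply: ler_sum => l _.
exact: overlapping_cycles_le.
Qed.

(** Each factor of Harris' product is 1 - u with u = p^k <= p, and 1 - u >= exp(-u/(1-u)) >=
    exp(-u/(1-p)). *)
Lemma pr_no_cycle_ge :
  expR (- (\sum_(m <- ms) cycle_weight m) / (1 - p)) <=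
  pr p (enum (pairs n)) (none_of cycle_family).
Proof.
apply: le_trans (prod_le_pr_none_of p0 p1 (enum_uniq _) cycle_family_sub).
have q0 : 0 < 1 - p by rewrite subr_gt0 edge_prob_lt1.
apply: le_trans (_ : expR (- (\sum_(C <- cycle_family) p ^+ #|C|) / (1 - p)) <= _).
  rewrite ler_expR ler_pM2r ?invr_gt0 // lerN2 big_cycle_family.
  by apply: ler_sum => m _; rewrite (eq_bigl _ _ (fun C => andbT _)) expected_cycles_le.
rewrite mulNr -mulrN mulr_suml expR_sum big_seq_cond [leRHS]big_seq_cond.
apply: ler_prod => C /andP[]; rewrite mem_cycle_family => /hasP[m _ /cyclesP[x xI ->]] _.
rewrite card_cyc_edges // expR_ge0 /=.
set u := p ^+ _.
have u0 : 0 <= u by rewrite exprn_ge0.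
have up : u <= p by rewrite /u exprS ler_piMr // exprn_ile1.
have u1 : 0 < 1 - u by rewrite (lt_le_trans q0) // lerB.
rewrite mulrN expRN -[leRHS]invrK lef_pV2 ?posrE ?expR_gt0 ?invr_gt0 //.
apply: le_trans (expR_ge1Dx _).
apply: le_trans (_ : 1 + u / (1 - u) <= _).
  by rewrite (_ : 1 + u / (1 - u) = (1 - u)^-1) //; field; rewrite gt_eqF.
by rewrite lerD2l ler_wpM2l // lef_pV2 ?posrE // lerB.
Qed.

End Families.
End CycleExpectation.

(** * Bicyclic subgraphs and edgeless graphs *)

Section Bicyclic.
Variable n : nat.
Implicit Types (G : rel 'I_n) (x : 'I_n) (s : seq 'I_n).

(* A bicyclic graph (theta, figure eight or dumbbell) has a Hamiltonian path
   both of whose ends send an extra edge back into the path. *)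
Definition bicyclic_path G x s i j :=
  [&& path G x s, uniq (x :: s), (1 < i <= size s)%N, (j.+1 < size s)%N,
      (i != size s) || (j != 0%N),
      G x (nth x (x :: s) i) & G (last x s) (nth x (x :: s) j)].

Definition bicyclic G := exists x s i j, bicyclic_path G x s i j.

Definition bicyclic_pattern m (i j : 'I_m.+1) : {set {set 'I_m.+1}} :=
  [set ord0; i] |: ([set ord_max; j] |:
    [set [set inord a; inord a.+1] | a : 'I_m]).

(** The three conditions say that neither extra edge is a path edge and that the two differ: m + 2
    edges on m + 1 vertices. *)
Lemma card_bicyclic_pattern m (i j : 'I_m.+1) :
  (1 < i)%N -> (j.+1 < m)%N -> (i != m :> nat) || (j != 0%N :> nat) ->
  #|bicyclic_pattern i j| = m.+2.
Proof.
move=> i1 jm ij.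
have K1 (a : 'I_m) : (inord a : 'I_m.+1) = a :> nat.
  by rewrite inordK // (leq_trans (ltn_ord a)).
have K2 (a : 'I_m) : (inord a.+1 : 'I_m.+1) = a.+1 :> nat.
  by rewrite inordK // ltnS ltn_ord.
rewrite !cardsU1 card_imset; last first.
  move=> a b /set2_eq[[/(congr1 val)]|[/(congr1 val) /= + /(congr1 val)/=]].
    by rewrite /= !K1 => /val_inj.
  by rewrite !K1 !K2 => ->; lia.
rewrite card_ord.
have -> : [set ord_max; j] \notin
    [set [set (inord a : 'I_m.+1); inord a.+1] | a : 'I_m].
  apply/imsetP => -[a _ /set2_eq[[/(congr1 val)/= + _]|]].
    by rewrite K1; have := ltn_ord a; lia.
  by move=> [/(congr1 val)/= + /(congr1 val)/=]; rewrite K1 K2; lia.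
have -> : [set ord0; i] \notin [set ord_max; j] |:
    [set [set (inord a : 'I_m.+1); inord a.+1] | a : 'I_m].
  rewrite !inE negb_or; apply/andP; split.
    apply/eqP => /set2_eq[[/(congr1 val)/= + _]|]; first by lia.
    by move=> [/(congr1 val)/= + /(congr1 val)/=]; move: ij; lia.
  apply/imsetP => -[a _ /set2_eq[]].
    by move=> [/(congr1 val)/= + /(congr1 val)/=]; rewrite K1 K2; lia.
  by move=> [/(congr1 val)/= + _]; rewrite K2.
by [].
Qed.

Definition edges_image m (t : {ffun 'I_m -> 'I_n}) (D : {set {set 'I_m}}) :
  {set {set 'I_n}} := [set t @: e | e : {set 'I_m} in D].

Lemma bicyclic_pathP (E : {set {set 'I_n}}) x s i j :
  bicyclic_path (graph_of E) x s i j ->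
  exists t : {ffun 'I_(size s).+1 -> 'I_n}, exists i' j' : 'I_(size s).+1,
   [/\ (size s < n)%N, injective t,
    [&& (1 < i')%N, (j'.+1 < size s)%N & (i' != size s :> nat) || (j' != 0%N :> nat)] &
    edges_image t (bicyclic_pattern i' j') \subset E].
Proof.
case/and5P => pxs uxs /andP[i1 im] jm /and3P[ij Gi Gj].
pose t := [ffun k : 'I_(size s).+1 => nth x (x :: s) k].
have tE (k : 'I_(size s).+1) : t k = nth x (x :: s) k by rewrite ffunE.
have iE : (inord i : 'I_(size s).+1) = i :> nat by rewrite inordK.
have jE : (inord j : 'I_(size s).+1) = j :> nat by rewrite inordK //; lia.
have tI : injective t.
  move=> a b; rewrite !tE => /eqP; rewrite nth_uniq //=.
  by move=> /eqP/val_inj.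
exists t, (inord i), (inord j); split=> //.
- by have := card_uniqP uxs; rewrite /= => <-; rewrite -[leqRHS]card_ord max_card.
- by rewrite iE jE i1 jm ij.
apply/subsetP => _ /imsetP[e + ->]; rewrite !inE => /or3P[/eqP->|/eqP->|].
- by rewrite imsetU1 imset_set1 !tE iE /=; case/andP: Gi.
- by rewrite imsetU1 imset_set1 !tE jE /= -(last_nth x); case/andP: Gj.
move=> /imsetP[a _ ->]; rewrite imsetU1 imset_set1 !tE.
rewrite !inordK ?ltnS ?ltn_ord ?(ltnW (ltn_ord a)) //.
by move/pathP: pxs => /(_ x a (ltn_ord a)) /andP[].
Qed.

End Bicyclic.

(** There are n^(m+1) vertex sequences and (m+1)^2 pairs of endpoints for the extra edges, each
    pattern having probability p^(m+2). *)
Lemma pr_bicyclic_le (R : realType) (c : R) n : 0 <= c -> c < 1 -> (0 < n)%N ->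
  pr (c / n%:R) (enum (pairs n)) (fun E => `[< bicyclic (graph_of E) >]) <=
  (\sum_(m < n) m.+1%:R ^+ 2 * c ^+ m.+2) / n%:R.
Proof.
move=> c0 c1 n0; set p := c / _.
have p0 : 0 <= p := edge_prob_ge0 n c0.
have p1 : p <= 1 by apply/ltW/edge_prob_lt1.
pose B m (u : {ffun 'I_m.+1 -> 'I_n} * 'I_m.+1 * 'I_m.+1) (E : {set {set 'I_n}}) :=
  [&& injectiveb u.1.1, (1 < u.1.2)%N, (u.2.+1 < m)%N,
   (u.1.2 != m :> nat) || (u.2 != 0%N :> nat) &
    edges_image u.1.1 (bicyclic_pattern u.1.2 u.2) \subset E].
have BE E : `[< bicyclic (graph_of E) >] ->
    has (fun m => [exists u, B m u E]) (iota 0 n).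
  move=> /asboolP[x [s [i [j /bicyclic_pathP[t [i' [j' [sn tI h1 h2]]]]]]]].
  apply/hasP; exists (size s); first by rewrite mem_iota.
  apply/existsP; exists (t, i', j'); case/and3P: h1 => h3 h4 h5.
  by rewrite /B /= h2 h3 h4 h5 !andbT; apply/injectiveP.
apply: le_trans (pr_union_bound p0 p1 _ BE) _.
rewrite mulr_suml -(big_mkord xpredT (fun m => m.+1%:R ^+ 2 * c ^+ m.+2 / n%:R)).
rewrite /index_iota subn0; apply: ler_sum => m _.
have B1 E : [exists u, B m u E] -> has (fun u => B m u E) (index_enum _).
  by move=> /existsP[u Bu]; apply/hasP; exists u => //; apply: mem_index_enum.
apply: le_trans (pr_union_bound p0 p1 _ B1) _.
apply: (@le_trans _ _ (\sum_(u : {ffun 'I_m.+1 -> 'I_n} * 'I_m.+1 * 'I_m.+1) p ^+ m.+2)).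
  apply: ler_sum => u _.
  have [h|h] := boolP [&& injectiveb u.1.1, (1 < u.1.2)%N, (u.2.+1 < m)%N &
   (u.1.2 != m :> nat) || (u.2 != 0%N :> nat)]; last first.
    rewrite /pr (@eq_Ex _ _ _ _ _ (fun=> 0)) ?Ex_const ?exprn_ge0 // => E.
    by move: h; rewrite /B !andbA; case: (_ && _).
  case/and4P: h => uI i1 jm ij; move/injectiveP: (uI) => uI'.
  have imI : injective (fun e : {set 'I_m.+1} => u.1.1 @: e) by apply: imset_inj.
  rewrite /pr (@eq_Ex _ _ _ _ _ (fun E =>
    (edges_image u.1.1 (bicyclic_pattern u.1.2 u.2) \subset E)%:R)); last first.
    by move=> E; rewrite /B uI i1 jm ij.
  rewrite Ex_sub ?enum_uniq //.
    by rewrite card_imset // card_bicyclic_pattern.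
  apply/subsetP => _ /imsetP[e eD ->]; rewrite mem_enum inE card_imset //.
  move: eD; rewrite !inE => /or3P[/eqP->|/eqP->|/imsetP[a _ ->]]; rewrite cards2.
  - by rewrite -(inj_eq val_inj) /= neq_ltn; move: i1; case: (nat_of_ord _).
  - rewrite -(inj_eq val_inj) /= neq_ltn; apply/eqP; congr (_.+1).
    by rewrite (leq_trans _ jm) ?orbT // ltnW.
  by rewrite -(inj_eq val_inj) /= !inordK ?ltnS ?ltn_ord ?(ltnW (ltn_ord a)) // neq_ltn ltnSn.
rewrite sumr_const -[_ *+ #|_|]mulr_natl.
have -> : #|{: {ffun 'I_m.+1 -> 'I_n} * 'I_m.+1 * 'I_m.+1}| = (n ^ m.+1 * m.+1 * m.+1)%N.
  by rewrite !card_prod card_ffun !card_ord.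
rewrite /p !natrM natrX expr_div_n [n%:R ^+ m.+2]exprS.
rewrite le_eqVlt; apply/orP; left; apply/eqP.
have nn : n%:R != 0 :> R by rewrite pnatr_eq0 -lt0n.
by field; rewrite nn expf_neq0.
Qed.

(** Edgeless graphs must be excluded, since their complex is a product of triangles and so
    contractible. Distinct single edges are disjoint, so the correction in Janson's inequality
    vanishes. *)
Lemma pr_no_edge_le (R : realType) (c : R) n : 0 <= c -> c < 1 -> (0 < n)%N ->
  pr (c / n%:R) (enum (pairs n)) (fun E => [disjoint E & pairs n]) <=
  expR (- (c * (n%:R - 1) / 2)).
Proof.
move=> c0 c1 n0; set p := c / _.
have p0 : 0 <= p := edge_prob_ge0 n c0.
have p1 : p <= 1 by apply/ltW/edge_prob_lt1.
pose cs := [seq [set e] | e <- enum (pairs n)].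
apply: le_trans (_ : pr p (enum (pairs n)) (none_of cs) <= _).
  apply: pr_le => // E dis; apply/allP => _ /mapP[e + ->]; rewrite mem_enum => en.
  by rewrite sub1set (disjointFl dis en).
have ucs : uniq cs by rewrite map_inj_uniq ?enum_uniq //; apply: set1_inj.
have cs_sub : all (fun C : {set {set 'I_n}} => C \subset enum (pairs n)) cs.
  apply/allP => _ /mapP[e en ->]; apply/subsetP => e'; rewrite inE => /eqP->.
  exact: en.
apply: le_trans (janson_le p0 p1 (enum_uniq _) ucs cs_sub) _.
rewrite [X in _ + X]big1_seq ?addr0 => [|C /andP[_ /mapP[e _ ->]]]; last first.
  rewrite big1_seq // => C' /andP[/andP[CC dis] /mapP[e' _ e'C]].
  by move: CC dis; rewrite e'C disjoints1 inE eq_sym (inj_eq set1_inj) negbK => /negPf ->.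
rewrite ler_expR lerN2 big_map.
rewrite (eq_bigr (fun=> p)) => [|e _]; last by rewrite cards1 expr1.
rewrite big_enum sumr_const -[_ *+ #|_|]mulr_natl card_draws card_ord.
have -> : 'C(n, 2)%:R = n%:R * (n%:R - 1) / 2 :> R.
  have : ('C(n, 2) * 2)%N%:R = (n * n.-1)%N%:R :> R.
    by rewrite -[X in ('C(n, 2) * X)%N]/(2`!) bin_ffact ffactnS ffactn1.
  by rewrite natrM natrM -[in n.-1%:R]subn1 natrB // => <-; field.
rewrite /p le_eqVlt; apply/orP; left; apply/eqP.
by field; rewrite pnatr_eq0 -lt0n.
Qed.

(** * Recoloring graphs all of whose cycles have length four *)

Lemma Zk_val_addr1 m (i : 'I_m.+3) :
  (i + 1 : 'I_m.+3) = (if i == m.+2 :> nat then 0%N else i.+1) :> nat.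
Proof.
rewrite /= (modn_small (m := 1)) // addn1; case: eqP => [->|ne]; first by rewrite modnn.
by rewrite modn_small //; have := ltn_ord i; lia.
Qed.

Lemma third_color (a b : 'I_3) : exists d : 'I_3, d != a /\ d != b.
Proof.
have : (0 < #|~: [set a; b]|)%N.
  by rewrite -(ltn_add2l #|[set a; b]|) addn0 cardsC card_ord cards2; case: (_ != _).
by move=> /card_gt0P[d]; rewrite !inE negb_or => /andP; exists d.
Qed.

Section Coloring.
Variables (n : nat) (G : rel 'I_n).
Hypotheses (Gsym : symmetric G) (Girr : irreflexive G).
Implicit Types (S : {set 'I_n}) (f g h : {ffun 'I_n -> 'I_3}) (u v w x y z : 'I_n).

Definition cycle_in m (x : {ffun 'I_m.+3 -> 'I_n}) :=
  injective x /\ forall i, G (x i) (x (i + 1)).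

Lemma maximal_path S x0 : x0 \in S -> exists x s,
  [/\ path G x s, uniq (x :: s), {subset x :: s <= S} &
      forall y, y \in S -> G x y -> y \in s].
Proof.
move=> x0S; suff H k : forall x s, (n - size s <= k)%N -> path G x s ->
    uniq (x :: s) -> {subset x :: s <= S} -> exists x s,
  [/\ path G x s, uniq (x :: s), {subset x :: s <= S} &
      forall y, y \in S -> G x y -> y \in s].
  by apply: (H _ x0 [::]) => // y; rewrite inE => /eqP->.
elim: k => [|k IH] x s sk ps us sS.
  by have := max_card [in x :: s]; rewrite (card_uniqP us) card_ord /=; lia.
case: (pickP [pred y | [&& y \in S, G x y & y \notin s]]) => /= [y /and3P[yS xy ys]|N].
  apply: (IH y (x :: s)); rewrite /= ?(Gsym y) ?xy //; first by lia.
    have yx : y != x by apply: contraTneq xy => ->; rewrite Girr.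
    by rewrite inE negb_or yx ys.
  by move=> z; rewrite inE => /orP[/eqP->//|/sS].
exists x, s; split=> // y yS xy; have := N y.
by rewrite /= yS xy /= => /negbFE.
Qed.

Lemma path_cycle x s i : path G x s -> uniq (x :: s) -> (i.+2 <= size s)%N ->
  G x (nth x (x :: s) i.+2) ->
  cycle_in [ffun k : 'I_i.+3 => nth x (x :: s) k].
Proof.
move=> ps us si Gx; split.
  move=> a b; rewrite !ffunE => /eqP; rewrite nth_uniq //=; first by move=> /eqP/val_inj.
    by apply: leq_trans (ltn_ord a) _; rewrite ltnS.
  by apply: leq_trans (ltn_ord b) _; rewrite ltnS.
move=> k; rewrite !ffunE Zk_val_addr1; case: eqP => [->|ki]; first by rewrite Gsym.
move/pathP: ps => /(_ x k); apply; have := ltn_ord k; lia.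
Qed.

(** The first case covers leaves and isolated vertices. In the second, any color or side that is
    admissible for [w] is admissible for [v]. *)
Definition foldable S v :=
  (exists u, forall y, y \in S -> G v y -> y = u) \/
  (exists w, [/\ w \in S, w != v & forall y, y \in S -> G v y -> G w y]).

Section OnlyFourCycles.
Hypothesis cycles4 : forall m (x : {ffun 'I_m.+3 -> 'I_n}), cycle_in x -> m = 1%N.

(** All neighbours of the start of a maximal path lie on it, and one at position k > 1 closes a
    (k+1)-cycle, so k = 3. Positions 1 and 3 are both adjacent to position 2. *)
Lemma exists_foldable S x0 : x0 \in S -> exists2 v, v \in S & foldable S v.
Proof.
move=> /maximal_path[x [s [ps us sS Nx]]].
exists x; first by rewrite sS ?mem_head.
case: s ps us sS Nx => [|x1 s] ps us sS Nx.
  by left; exists x => y yS xy; have := Nx y yS xy.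
have x4 y : y \in S -> G x y -> y = x1 \/ (2 < size (x1 :: s))%N /\
    y = nth x [:: x, x1 & s] 3.
  move=> yS xy; have ys := Nx y yS xy.
  have [->|yx1] := eqVneq y x1; [by left|right].
  have /(nthP x)[i si iy] : y \in s by move: ys; rewrite inE (negPf yx1).
  have := @path_cycle x (x1 :: s) i ps us; rewrite /= ltnS si => /(_ isT).
  by rewrite iy => /(_ xy)/cycles4 i1; rewrite -iy i1; split=> //; rewrite i1 in si.
case: (pickP [pred y | [&& y \in S, G x y & y != x1]]) => /= [y /and3P[yS xy ys]|N].
  have [yx1|[s2 y3]] := x4 y yS xy; first by rewrite yx1 eqxx in ys.
  rewrite /= in s2; right; exists (nth x [:: x, x1 & s] 2); split.
  - by apply/sS/mem_nth; rewrite /= ltnS; lia.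
  - rewrite -[X in _ != X]/(nth x [:: x, x1 & s] 0) nth_uniq //=; lia.
  move=> z zS xz; have [->|[_ ->]] := x4 z zS xz.
    by rewrite Gsym; move/pathP: ps => /(_ x 1%N); apply; rewrite /=; lia.
  by move/pathP: ps => /(_ x 2); apply; rewrite /=; lia.
left; exists x1 => y yS xy; have := N y.
by rewrite /= yS xy /= => /negbFE/eqP.
Qed.

Lemma fold_ind (P : {set 'I_n} -> Prop) : P set0 ->
  (forall S v, v \in S -> foldable S v -> P (S :\ v) -> P S) -> forall S, P S.
Proof.
move=> P0 PS S; have [k] := ubnP #|S|; elim: k S => // k IH S Sk.
have [->//|[x0 x0S]] := set_0Vmem S.
have [v vS vf] := exists_foldable x0S.
by apply: (PS S v vS vf); apply: IH; move: Sk; rewrite (cardsD1 v) vS.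
Qed.

Lemma bipartite : exists f : 'I_n -> bool, forall x y, G x y -> f x != f y.
Proof.
suff [f Hf] : exists f : 'I_n -> bool, forall x y, x \in [set: 'I_n] ->
    y \in [set: 'I_n] -> G x y -> f x != f y.
  by exists f => x y; apply: Hf; rewrite inE.
apply: (fold_ind (P := fun S => exists f : 'I_n -> bool, forall x y, x \in S ->
    y \in S -> G x y -> f x != f y)) => [|S v vS vf [f Hf]].
  by exists xpredT => x y; rewrite inE.
have [b Hb] : exists b, forall y, y \in S -> G v y -> b != f y.
  case: vf => [[u Hu]|[w [wS wv Hw]]].
    by exists (~~ f u) => y yS /(Hu y yS)->; case: (f u).
  exists (f w) => y yS vy; apply: Hf; rewrite ?in_setD1 ?wv ?yS ?andbT //; last exact: Hw.
  by apply: contraTneq vy => ->; rewrite Girr.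
exists (fun x => if x == v then b else f x) => x y xS yS.
have [->|xv] := eqVneq x v; have [->|yv] := eqVneq y v => Gxy.
- by rewrite Girr in Gxy.
- exact: Hb.
- by rewrite eq_sym; apply: Hb; rewrite // Gsym.
- by apply: Hf => //; rewrite in_setD1 ?xv ?yv.
Qed.

End OnlyFourCycles.

(** * Connecting 3-colorings by single-vertex recolorings *)

Definition proper S f := forall x y, x \in S -> y \in S -> G x y -> f x != f y.

Definition recolor f z a : {ffun 'I_n -> 'I_3} := [ffun x => if x == z then a else f x].

(** Colorings are total but constrained only on [S]; a step may recolor a vertex outside [S]. *)
Inductive reach S f : {ffun 'I_n -> 'I_3} -> Prop :=
| reach_refl : reach S f f
| reach_step g z a : reach S f g -> proper S (recolor g z a) ->
    reach S f (recolor g z a).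

Lemma properD1 S v f : proper (S :\ v) f ->
  (forall y, y \in S -> G v y -> f v != f y) -> proper S f.
Proof.
move=> Hf Hv x y xS yS.
have [->|xv] := eqVneq x v; first exact: Hv.
have [-> Gxv|yv] := eqVneq y v; first by rewrite eq_sym Hv // Gsym.
by apply: Hf; rewrite in_setD1 ?xv ?yv.
Qed.

Lemma properS S S' f : S' \subset S -> proper S f -> proper S' f.
Proof. by move=> /subsetP SS Hf x y /SS xS /SS yS; apply: Hf. Qed.

Lemma eq_proper S f g : {in S, f =1 g} -> proper S f -> proper S g.
Proof. by move=> fg Hf x y xS yS; rewrite -!fg //; apply: Hf. Qed.

(** With a single neighbour, two colors are forbidden and the third is free. In a fold the color of
    [w] works: if a neighbour of [v] is recolored, then [w], adjacent to it, is not. *)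
Lemma foldable_flex S v h z a : foldable S v ->
  proper (S :\ v) h -> proper (S :\ v) (recolor h z a) ->
  exists d, forall y, y \in S -> G v y -> d != h y /\ d != recolor h z a y.
Proof.
case=> [[u Hu] _ _|[w [wS wv Hw]] Hh Hh'].
  have [d [d1 d2]] := third_color (h u) (recolor h z a u).
  by exists d => y yS /(Hu y yS)->.
exists (h w) => y yS vy; have wy := Hw y yS vy.
have yv : y != v by apply: contraTneq vy => ->; rewrite Girr.
have wS' : w \in S :\ v by rewrite in_setD1 wv.
have yS' : y \in S :\ v by rewrite in_setD1 yv.
split; first exact: Hh.
have [yz|yz] := eqVneq y z; last by rewrite ffunE (negPf yz); apply: Hh.
have wz : w != z by rewrite -yz; apply: contraTneq wy => ->; rewrite Girr.
by have := Hh' _ _ wS' yS' wy; rewrite [recolor _ _ _ w]ffunE (negPf wz).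
Qed.

(** Before [z] is recolored, [v] moves to a color allowed both before and after. A step that
    recolors [v] itself is dropped. *)
Lemma reach_lift S v h g : v \in S -> foldable S v -> reach (S :\ v) h g ->
  forall h', proper S h' -> {in S :\ v, h' =1 h} ->
  exists g', [/\ reach S h' g', proper S g' & {in S :\ v, g' =1 g}].
Proof.
move=> vS vf hg h' Hh' hh'; elim: hg => {g} [|g z a hg [g' [hg' Hg' gg']] Hg].
  by exists h'; split=> //; left.
have Hg0 : proper (S :\ v) g.
  by apply: eq_proper gg' _; apply: properS Hg'; apply: subsetDl.
have [zv|zv] := eqVneq z v.
  exists g'; split=> // x xS; rewrite ffunE zv gg' //.
  by move: xS; rewrite in_setD1 => /andP[/negPf->].
have [d Hd] := foldable_flex vf Hg0 Hg.
have NV y : G v y -> y != v by apply: contraTneq => ->; rewrite Girr.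
have P1 : proper S (recolor g' v d).
  apply: properD1 => [|y yS vy].
    apply: eq_proper Hg0 => x xS; rewrite ffunE -gg' //.
    by move: xS; rewrite in_setD1 => /andP[/negPf->].
  rewrite !ffunE eqxx (negPf (NV _ vy)) gg' ?in_setD1 ?NV //.
  by have [] := Hd y yS vy.
have E2 : {in S :\ v, recolor (recolor g' v d) z a =1 recolor g z a}.
  move=> x xS; rewrite !ffunE; case: eqP => // _; rewrite gg' //.
  by move: xS; rewrite in_setD1 => /andP[/negPf->].
have P2 : proper S (recolor (recolor g' v d) z a).
  apply: properD1 => [|y yS vy].
    by apply: eq_proper Hg => x xS; rewrite E2.
  rewrite (E2 y) ?in_setD1 ?NV // !ffunE [v == z]eq_sym (negPf zv) eqxx.
  by have [_] := Hd y yS vy; rewrite ffunE.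
exists (recolor (recolor g' v d) z a); split=> //.
by right => //; right.
Qed.

Lemma recolor_connected f g :
  (forall m (x : {ffun 'I_m.+3 -> 'I_n}), cycle_in x -> m = 1%N) ->
  proper setT f -> proper setT g -> reach setT f g.
Proof.
move=> cycles4; suff H : forall S, proper S f -> proper S g ->
    exists g', reach S f g' /\ {in S, g' =1 g}.
  move=> Hf Hg; have [g' [r e]] := H _ Hf Hg.
  by suff <- : g' = g by []; apply/ffunP => x; apply: e.
apply: (fold_ind cycles4) => [|S v vS vf IH Hf Hg].
  by exists f; split; [left|move=> x; rewrite inE].
have sub : S :\ v \subset S by apply: subsetDl.
have [g' [r e]] := IH (properS sub Hf) (properS sub Hg).
have [g2 [r2 Hg2 e2]] := reach_lift vS vf r Hf (fun _ _ => erefl).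
have E : {in S, recolor g2 v (g v) =1 g}.
  move=> x xS; rewrite ffunE; case: eqP => [->//|/eqP xv].
  by rewrite e2 ?e // in_setD1 xv.
exists (recolor g2 v (g v)); split=> //; right=> //.
by apply: eq_proper Hg => x xS; rewrite E.
Qed.

End Coloring.

(** * Graphs without bicyclic subgraphs *)

Lemma Zk_natr_m2 m : m.+2%:R = -1 :> 'I_m.+3.
Proof.
apply/eqP; rewrite -subr_eq0 opprK natr1 Zp_nat -(inj_eq val_inj) /=.
by rewrite modnn.
Qed.

Section Unicyclic.
Variables (n : nat) (G : rel 'I_n).
Hypotheses (Gsym : symmetric G) (Girr : irreflexive G).
Implicit Types (S : {set 'I_n}) (f g h : {ffun 'I_n -> 'I_3}) (u v w y z : 'I_n).

Section Cycle.
Variables (m : nat) (x : {ffun 'I_m.+3 -> 'I_n}).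
Hypothesis cx : cycle_in G x.
Let xI : injective x. Proof. by case: cx. Qed.
Let xG i : G (x i) (x (i + 1)). Proof. by case: cx. Qed.

(** The cycle cut open just before [x r]: a path from [x r] round to [x (r - 1)], whose last vertex
    sends an edge back to the first. *)
Definition cycle_tail r := mkseq (fun i => x (r + i.+1%:R)) m.+2.
Arguments cycle_tail : simpl never.

Lemma size_cycle_tail r : size (cycle_tail r) = m.+2.
Proof. exact: size_mkseq. Qed.

Lemma nth_cycle_tail y r k : (k < m.+3)%N ->
  nth y (x r :: cycle_tail r) k = x (r + k%:R).
Proof.
by case: k => [_|k km]; rewrite ?addr0 //= /cycle_tail nth_mkseq.
Qed.

Lemma path_cycle_tail r : path G (x r) (cycle_tail r).
Proof.
apply/(pathP (x r)) => k; rewrite size_cycle_tail => km.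
rewrite nth_cycle_tail ?(leq_trans km) // nth_mkseq // -natr1 addrA.
exact: xG.
Qed.

Lemma last_cycle_tail y r : last (x r) (cycle_tail r) = x (r - 1).
Proof.
rewrite (last_nth y) size_cycle_tail nth_cycle_tail //; congr (x (_ + _)).
by rewrite Zk_natr_m2.
Qed.

Lemma uniq_cycle_tail r : uniq (x r :: cycle_tail r).
Proof.
have -> : x r :: cycle_tail r = mkseq (fun k => x (r + k%:R)) m.+3.
  apply: (@eq_from_nth _ (x r)) => [|k].
    by rewrite [RHS]size_mkseq; congr (_.+1); apply: size_cycle_tail.
  rewrite [size _](congr1 succn (size_cycle_tail r)) => km.
  by rewrite -[nth _ (x r :: _) k]/(nth (x r) (x r :: cycle_tail r) k)
    nth_cycle_tail // nth_mkseq.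
apply/mkseq_uniqP => i j; rewrite !inE => im jm /xI/addrI.
by move/(congr1 val); rewrite !Zp_nat /= !modn_small.
Qed.

Lemma mem_cycle_tail r b : exists2 k, (k < m.+3)%N &
  x b = nth (x r) (x r :: cycle_tail r) k /\ k = (b - r : 'I_m.+3) :> nat.
Proof.
exists (b - r : 'I_m.+3)%R => //; rewrite nth_cycle_tail // natr_Zp.
by rewrite addrC subrK.
Qed.

Lemma cycle_tail_sub r y : y \in x r :: cycle_tail r -> y \in codom x.
Proof.
by rewrite inE => /orP[/eqP->|/mapP[k _ ->]]; apply: codom_f.
Qed.

Hypothesis NB : ~ bicyclic G.

(** A cycle with a chord is a theta graph: the path round the cycle starts at one end of the chord,
    and the closing edge is the second extra edge. *)
Lemma chordless i j : G (x i) (x j) -> j = i + 1 \/ i = j + 1.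
Proof.
move=> Gij; have [k km [ek kE]] := mem_cycle_tail i j.
have jE : j = i + k%:R by rewrite kE natr_Zp addrC subrK.
have [k0|k0] := eqVneq k 0%N; first by move: Gij; rewrite jE k0 addr0 Girr.
have [k1|k1] := eqVneq k 1%N; first by left; rewrite jE k1.
have [k2|k2] := eqVneq k m.+2.
  by right; rewrite jE k2 Zk_natr_m2 subrK.
case: NB; exists (x i), (cycle_tail i), k, 0%N; apply/and5P; split.
- exact: path_cycle_tail.
- exact: uniq_cycle_tail.
- by rewrite size_cycle_tail; lia.
- by rewrite size_cycle_tail.
rewrite size_cycle_tail k2 -ek Gij !andTb -[nth _ _ 0]/(x i) (last_cycle_tail (x i)).
by rewrite -[X in G _ (x X)](subrK 1) xG.
Qed.

Lemma attached_figure_eight a b d : a \notin codom x ->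
  G a (x b) -> G a (x d) -> b = d.
Proof.
move=> ax Gb Gd; apply: contrapT => bd; apply: NB.
have [k km [ek kE]] := mem_cycle_tail b d.
have k0 : k != 0%N.
  by apply/eqP => k0; apply/bd/xI; rewrite ek k0.
exists a, (x b :: cycle_tail b), k.+1, 1%N; apply/and5P; split.
- by apply/andP; split; [|apply: path_cycle_tail].
- rewrite cons_uniq uniq_cycle_tail andbT; apply: contra ax.
  exact: cycle_tail_sub.
- by rewrite -[size (x b :: _)]/(size (cycle_tail b)).+1 size_cycle_tail; lia.
- by rewrite -[size (x b :: _)]/(size (cycle_tail b)).+1 size_cycle_tail.
rewrite orbT andTb -[nth _ _ k.+1]/(nth a (x b :: cycle_tail b) k).
rewrite [nth a (x b :: _) k](set_nth_default (x b)); last first.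
  by rewrite -[size (x b :: _)]/(size (cycle_tail b)).+1 size_cycle_tail.
rewrite -ek Gd -[last _ _]/(last (x b) (cycle_tail b)) -[nth _ _ _]/(x b).
by rewrite (last_cycle_tail a) -[X in G _ (x X)](subrK 1) xG.
Qed.

(** The initial segment of the path closes to a cycle through [a]. It is run backwards so as to end
    at [a] and continue round the cycle [x]. *)
Lemma attached_dumbbell a s b i : path G a s -> uniq (a :: s) ->
  {in a :: s, forall z, z \notin codom x} -> G a (x b) ->
  (1 < i <= size s)%N -> G a (nth a (a :: s) i) -> False.
Proof.
move=> ps us sx Gb /andP[i1 si] Gy; apply: NB.
pose q := take i s; pose y := last a q; pose t := rev (belast a q).
have sq : size q = i by rewrite size_takel.
have st : size t = i by rewrite size_rev size_belast.
have yE : y = nth a (a :: s) i.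
  by rewrite /y (last_nth a) sq -[a :: q]/(take i.+1 (a :: s)) nth_take.
have ty : y :: t = rev (a :: q) by rewrite [in RHS]lastI rev_rcons.
have lt : last y t = a.
  by rewrite /t; case: (q) sq i1 => [<-//|z q' _ _] /=; rewrite rev_cons last_rcons.
exists y, (t ++ x b :: cycle_tail b), i, i.+1; apply/and5P; split.
- have px : path G a (x b :: cycle_tail b).
    by apply/andP; split; [|apply: path_cycle_tail].
  rewrite cat_path lt px /y /t rev_path.
  rewrite (eq_path (e' := G)) => [|z z' //]; rewrite andbT.
  by have := take_path i ps.
- rewrite -cat_cons ty cat_uniq rev_uniq uniq_cycle_tail andbT.
  apply/andP; split; first by have := take_uniq i.+1 us.
  apply/hasPn => z /cycle_tail_sub; apply: contraL; rewrite mem_rev => zq.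
  by apply: sx; apply: (mem_take (n0 := i.+1)).
- by rewrite i1 size_cat st leq_addr.
- by rewrite size_cat st -[size (x b :: _)]/(size (cycle_tail b)).+1 size_cycle_tail; lia.
have -> : nth y (y :: t ++ x b :: cycle_tail b) i = a.
  by rewrite -cat_cons nth_cat -[size (y :: t)]/(size t).+1 st ltnS leqnn -st -last_nth.
have -> : nth y (y :: t ++ x b :: cycle_tail b) i.+1 = x b.
  by rewrite -cat_cons nth_cat -[size (y :: t)]/(size t).+1 st ltnn subnn.
rewrite orbT Gsym yE Gy last_cat -[last _ _]/(last (x b) (cycle_tail b)).
rewrite (last_cycle_tail a).
by rewrite -[X in G _ (x X)](subrK 1) xG.
Qed.

End Cycle.

Lemma path_theta a s i j : ~ bicyclic G -> path G a s -> uniq (a :: s) ->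
  (1 < i)%N -> (i < j <= size s)%N ->
  G a (nth a (a :: s) i) -> G a (nth a (a :: s) j) -> False.
Proof.
move=> NB ps us i1 /andP[ij js] Gi Gj; apply: NB.
have sq : size (take j s) = j by rewrite size_takel.
have qE k : (k <= j)%N -> nth a (a :: take j s) k = nth a (a :: s) k.
  by move=> kj; rewrite -[a :: take j s]/(take j.+1 (a :: s)) nth_take.
exists a, (take j s), i, 0%N; apply/and5P; split.
- exact: take_path.
- by have := take_uniq j.+1 us.
- by rewrite sq i1 ltnW.
- by rewrite sq; lia.
by rewrite sq neq_ltn ij /= qE 1?ltnW // Gi (last_nth a) sq qE // Gsym.
Qed.

(** * Extending a coloring from a cycle to the whole graph *)

Section Extension.
Variables (m : nat) (x : {ffun 'I_m.+3 -> 'I_n}).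
Hypotheses (cx : cycle_in G x) (NB : ~ bicyclic G).

(** The start of a maximal path off the cycle has at most one neighbour besides its successor: two
    more, each on the cycle or on the path, would create one of the shapes excluded above. *)
Lemma exists_degree_le2 S v0 : v0 \in S -> v0 \notin codom x ->
  exists2 v, v \in S /\ v \notin codom x &
    exists a b, forall y, y \in S -> G v y -> y = a \/ y = b.
Proof.
move=> v0S v0x; pose S' := [set v in S | v \notin codom x].
have : v0 \in S' by rewrite inE v0S.
move=> /(maximal_path Gsym Girr)[a [s [ps us sS Na]]].
have sx : {in a :: s, forall z, z \notin codom x}.
  by move=> z /sS; rewrite inE => /andP[].
have /sS : a \in a :: s by apply: mem_head.
rewrite inE => /andP[aS ax].
exists a => //; pose a1 := head a s; exists a1.
have key y y' : y \in S -> y' \in S -> G a y -> G a y' -> y != a1 -> y' != a1 -> y = y'.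
  have idx z : z \in S -> G a z -> z != a1 -> z \notin codom x ->
      exists2 i, (1 < i <= size s)%N & z = nth a (a :: s) i.
    move=> zS az za zx; have := Na z; rewrite inE zS => /(_ zx az) /(nthP a)[i si zE].
    exists i.+1; last by rewrite -zE.
    by case: i si zE => // si; rewrite nth0 => /esym/eqP; rewrite (negPf za).
  move=> yS yS' ay ay' ya ya'.
  have [/codomP[b yE]|yx] := boolP (y \in codom x);
    have [/codomP[b' yE']|yx'] := boolP (y' \in codom x).
  - by rewrite yE yE'; congr (x _); apply: (attached_figure_eight cx NB ax); rewrite -?yE -?yE'.
  - have [i si iE] := idx _ yS' ay' ya' yx'.
    case: (attached_dumbbell cx NB ps us sx _ si (b := b)); first by rewrite -yE.
    by rewrite -iE.
  - have [i si iE] := idx _ yS ay ya yx.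
    case: (attached_dumbbell cx NB ps us sx _ si (b := b')); first by rewrite -yE'.
    by rewrite -iE.
  have [i /andP[i1 si] iE] := idx _ yS ay ya yx.
  have [j /andP[j1 sj] jE] := idx _ yS' ay' ya' yx'.
  have [ij|ji|ij] := ltngtP i j; last by rewrite iE jE ij.
    by case: (path_theta NB ps us i1 (j := j)); rewrite ?ij -?iE -?jE.
  by case: (path_theta NB ps us j1 (j := i)); rewrite ?ji -?iE -?jE.
case: (pickP [pred y | [&& y \in S, G a y & y != a1]]) => /= [b /and3P[bS ab ba]|N].
  exists b => y yS ay; have [->|ya] := eqVneq y a1; [by left|right].
  exact: key.
exists a => y yS ay; left; have := N y.
by rewrite /= yS ay /= => /negbFE/eqP.
Qed.

(** Vertices off the cycle are removed while they have at most two neighbours left, then colored in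
    reverse order with a third color. Only the cycle remains, and it has no chords. *)
Lemma extend_coloring (col : 'I_m.+3 -> 'I_3) :
  (forall i, col i != col (i + 1)) ->
  exists f, proper G setT f /\ forall i, f (x i) = col i.
Proof.
move=> Hc; have xI : injective x by case: cx.
suff H k : forall S, (#|S| <= k)%N -> exists f, proper G S f /\ forall i, x i \in S -> f (x i) = col i.
  have [f [Hf fc]] := H _ setT (leqnn _).
  by exists f; split=> // i; apply: fc; rewrite inE.
elim: k => [|k IH] S Sk.
  exists [ffun=> ord0]; move: Sk; rewrite leqn0 cards_eq0 => /eqP->.
  by split=> [u v|i]; rewrite inE.
have [[v vS vx]|Sx] := pselect (exists2 v, v \in S & v \notin codom x).
  have {v vS vx} [v [vS vx] [a [b Hab]]] := exists_degree_le2 vS vx.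
  have [|f [Hf fc]] := IH (S :\ v); first by move: Sk; rewrite (cardsD1 v) vS.
  have [d [da db]] := third_color (f a) (f b).
  exists (recolor f v d); split=> [|i xiS].
    apply: (properD1 Gsym (v := v)) => [|y yS vy].
      apply: eq_proper Hf => z zS; rewrite ffunE.
      by move: zS; rewrite in_setD1 => /andP[/negPf->].
    rewrite !ffunE eqxx; have [yv|_] := eqVneq y v; first by rewrite yv Girr in vy.
    by have [->|->] := Hab y yS vy.
  have xiv : x i != v by apply: contraNneq vx => <-; apply: codom_f.
  by rewrite ffunE (negPf xiv) fc // in_setD1 xiv.
have SE v : v \in S -> exists i, v = x i.
  by move=> vS; apply/codomP; apply: contrapT => /negP vx; apply: Sx; exists v.
exists [ffun v => if [pick i | x i == v] is Some i then col i else ord0].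
have fE i : [ffun v => if [pick i | x i == v] is Some i then col i else ord0] (x i) = col i.
  rewrite ffunE; case: pickP => [j /eqP/xI->//|/(_ i)]; by rewrite eqxx.
split=> // u v /SE[i ->] /SE[j ->]; rewrite !fE.
by move=> /(chordless cx NB)[->|->]; [|rewrite eq_sym]; apply: Hc.
Qed.

End Extension.
End Unicyclic.

(** * Winding numbers of colorings *)

(** The representative of b - a modulo 3 in {-1, 0, 1}. *)
Definition turn (a b : 'I_3) : int := if b == a + 1 then 1 else if b == a then 0 else -1.

Lemma I3_ind (P : 'I_3 -> Prop) : P 0 -> P 1 -> P (1 + 1) -> forall a, P a.
Proof.
move=> p0 p1 p2 [[|[|[|//]]] ia].
- by rewrite (_ : Ordinal ia = 0) //; apply: val_inj.
- by rewrite (_ : Ordinal ia = 1) //; apply: val_inj.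
- by rewrite (_ : Ordinal ia = 1 + 1) //; apply: val_inj.
Qed.

Lemma turnN a b : turn (- a) (- b) = - turn a b.
Proof. by elim/I3_ind: a; elim/I3_ind: b. Qed.

Lemma turn_xx a : turn a a = 0.
Proof. by elim/I3_ind: a. Qed.

Lemma turn_succ k : turn k%:R k.+1%:R = 1.
Proof. by rewrite /turn -natr1 eqxx. Qed.

Lemma turn_pred k : turn k.+1%:R k%:R = -1.
Proof. by rewrite /turn -natr1; elim/I3_ind: (k%:R). Qed.

(** With three colors, {a, a'} and {b, b'} can only be disjoint if a = a' or b = b'. The right-hand
    side is a difference of vertex terms, so it telescopes round a cycle. *)
Lemma turn_compat a a' b b' : a != b -> a != b' -> a' != b -> a' != b' ->
  turn a' b' - turn a b = 2 * turn a a' - 2 * turn b b'.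
Proof.
by elim/I3_ind: a; elim/I3_ind: a' => //; elim/I3_ind: b => //; elim/I3_ind: b'.
Qed.

(** Signed number of steps along the hexagon of ordered pairs of distinct colors; one full circuit
    turns each color by 3. *)
Definition turn2 (a b : 'I_3 * 'I_3) : int := turn a.1 b.1 + turn a.2 b.2.

Definition disjoint_colors (a b : 'I_3 * 'I_3) := (a.1 != b.2) && (b.1 != a.2).

(** The pairs lie in one cell of the hexagon, so each coordinate takes at most two colors, and on
    two colors [turn] is additive. *)
Lemma turn2_add a b c : disjoint_colors a a -> disjoint_colors b b ->
  disjoint_colors c c -> disjoint_colors a b -> disjoint_colors b c ->
  disjoint_colors a c -> turn2 a b + turn2 b c = turn2 a c.
Proof.
case: a => a a'; case: b => b b'; case: c => c c'.
elim/I3_ind: a; elim/I3_ind: a' => //; elim/I3_ind: b => //; elim/I3_ind: b' => //;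
  by elim/I3_ind: c => //; elim/I3_ind: c'.
Qed.

Section Winding.
Variables (n : nat) (G : rel 'I_n).
Hypotheses (Gsym : symmetric G) (Girr : irreflexive G).
Implicit Types (f g : {ffun 'I_n -> 'I_3}).

(** For proper [f], [g] and symmetric [G]: the two vertices of the complex lie in a common cell. *)
Definition compat f g := forall u v, G u v -> f u != g v.

Variables (m : nat) (x : {ffun 'I_m.+3 -> 'I_n}).
Hypothesis cx : cycle_in G x.

(** For a proper coloring, three times the degree of the induced map from the cycle to the
    triangle. *)
Definition winding f : int := \sum_i turn (f (x i)) (f (x (i + 1))).

Lemma winding_compat f g : compat f f -> compat g g -> compat f g ->
  winding f = winding g.
Proof.
move=> ff gg fg; have xG := cx.2.
apply/eqP; rewrite eq_sym -subr_eq0 -sumrB.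
under eq_bigr => i _.
  rewrite turn_compat ?ff ?gg ?fg //; last by rewrite eq_sym fg // Gsym.
over.
rewrite sumrB subr_eq0; apply/eqP.
rewrite [LHS](reindex_inj (h := fun i => i + 1)) //.
exact: addIr.
Qed.

Lemma winding_opp f : winding [ffun v => - f v] = - winding f.
Proof.
by rewrite /winding -sumrN; apply: eq_bigr => i _; rewrite !ffunE turnN.
Qed.

(* The color of the [k]-th vertex is the residue mod 3 of a walk on the integers
   that climbs to [top], a nonzero multiple of 3, and then oscillates there. *)
Definition height (top k : nat) : nat := if (k <= top)%N then k else (top - odd (top + k))%N.

Lemma heightS top k : (0 < top)%N ->
  height top k.+1 = (height top k).+1 \/ height top k = (height top k.+1).+1.
Proof.
rewrite /height addnS /= => t0; case: (ltngtP k top) => kt.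
- by left.
- by case: (odd _) => /=; lia.
by rewrite kt addnn odd_double /=; right; lia.
Qed.

Lemma height_top top k : odd k = odd top -> (top <= k)%N -> height top k = top.
Proof.
rewrite /height => ok tk; case: leqP => kt; first by lia.
by rewrite oddD ok addbb subn0.
Qed.

Lemma nonzero_winding : ~ bicyclic G -> m != 1%N ->
  exists f, proper G setT f /\ winding f != 0.
Proof.
(* The walk must end at a nonzero multiple of 3 that has the parity of the length and does not
   exceed it; among lengths at least 3 this fails only for 4. *)
move=> NB m1; pose top := if odd m.+3 then 3%N else 6%N.
pose col (i : 'I_m.+3) : 'I_3 := (height top i)%:R.
have t0 : (0 < top)%N by rewrite /top; case: ifP.
have hm : height top m.+3 = top.
  apply: height_top; rewrite /top; first by case: ifP.
  by case: (m) m1 => [|[|[|k]]] //= _; case: ifP.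
have colS i : col (i + 1) = (height top i.+1)%:R.
  rewrite /col Zk_val_addr1; case: eqP => // ->.
  rewrite hm.
  by rewrite /top; case: ifP => _; apply/val_inj; rewrite Zp_nat.
have turnE i : turn (col i) (col (i + 1)) = (height top i.+1)%:Z - (height top i)%:Z.
  rewrite colS /col; have [->|->] := heightS i t0.
    by rewrite turn_succ; lia.
  by rewrite turn_pred; lia.
have [|f [Hf fc]] := extend_coloring Gsym Girr cx NB (col := col).
  move=> i; apply/eqP => e; have := turnE i; rewrite -e turn_xx.
  by have [->|->] := heightS i t0; lia.
exists f; split=> //; rewrite /winding.
under eq_bigr do rewrite !fc turnE.
rewrite -(big_mkord xpredT (fun i => (height top i.+1)%:Z - (height top i)%:Z)).
by rewrite telescope_sumr // hm subr0 eqz_nat -lt0n.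
Qed.

Lemma two_windings : ~ bicyclic G -> m != 1%N ->
  exists f g, [/\ proper G setT f, proper G setT g & winding f != winding g].
Proof.
move=> NB m1; have [f [Hf wf]] := nonzero_winding NB m1.
exists f, [ffun v => - f v]; split=> //.
  by move=> u v _ _ uv; rewrite !ffunE eqr_opp Hf // inE.
rewrite winding_opp; move: wf; move: (winding f) => w; lia.
Qed.

End Winding.

(** * Paths in Hom(G, K_3) *)

Local Open Scope classical_set_scope.

Lemma uniform_continuity (R : realType) (X : pseudoMetricType R) n k (A : set X)
    (H : X -> 'M[R]_(n, k)) (e : R) :
  compact A -> {within A, continuous H} -> 0 < e ->
  exists2 d : R, 0 < d & forall z z', A z -> A z' -> ball z d z' ->
    forall i j, `|H z i j - H z' i j| < e.
Proof.
move=> /compact_near_coveringP cA /subspace_continuousP cH e0.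
pose P (d : R) (z : X) := forall z', A z -> A z' -> ball z d z' ->
  forall i j, `|H z i j - H z' i j| < e.
have e2 : 0 < e / 2 by rewrite divr_gt0.
have : \forall d \near (0 : R)^'+, A `<=` P d.
  apply: cA => x Ax.
  have : within A (nbhs x) [set z | forall i j, `|H x i j - H z i j| < e / 2].
    have /(cH x Ax) // : nbhs (H x) [set N | forall i j, `|H x i j - N i j| < e / 2].
    by apply/nbhs_ballP; exists (e / 2) => //= N [_ hN] i j; apply: (hN i j).
  move=> /nbhs_ballP[r /= r0 hr].
  have r2 : 0 < r / 2 by rewrite divr_gt0.
  exists (ball x (r / 2), [set d | d < r / 2]) => /=.
    split; first exact: nbhsx_ballx.
    exact: nbhs_right_lt.
  move=> [z d] /= [xz dr] z' Az Az' zz' i j.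
  have h1 : `|H x i j - H z i j| < e / 2.
    by apply: hr => //; apply: le_ball xz; lra.
  have h2 : `|H x i j - H z' i j| < e / 2.
    apply: hr => //; rewrite [r]splitr; apply: ball_triangle xz _.
    exact: le_ball (ltW dr) _ zz'.
  have := ler_distD (H x i j) (H z i j) (H z' i j).
  by rewrite (distrC (H z i j) (H x i j)); lra.
move=> hP; have [d [d0 Pd]] : exists d : R, 0 < d /\ A `<=` P d.
  near (0 : R)^'+ => d; exists d; split; first by near: d; apply: nbhs_right_gt.
  by near: d.
by exists d => // z z' Az Az'; apply: Pd.
Unshelve. all: by end_near.
Qed.

Section HomSpace.
Variables (R : realType) (n : nat) (G : rel 'I_n).
Hypothesis Gsym : symmetric G.
Notation X := (Hom_space (R:=R) G (K 3)).
Implicit Types (f g : {ffun 'I_n -> 'I_3}) (M N : 'M[R]_(n, 3)).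

Definition stochastic M := forall v, (forall k, 0 <= M v k) /\ \sum_k M v k = 1.

(** The supports of the rows of a point form a cell containing it, so cells can be forgotten. *)
Lemma Hom_spaceP M : X M <->
  stochastic M /\ forall u v, G u v -> forall k, M u k = 0 \/ M v k = 0.
Proof.
split=> [[eta /= /andP[_ /forallP eG] Me]|[Ms MG]].
  split=> [v|u v uv k]; first by have [? []] := Me v.
  have [Hu [_ Mu]] := Me u; have [Hv [_ Mv]] := Me v.
  have [ku|/Mu] := boolP (k \in eta u); last by left.
  have [kv|/Mv] := boolP (k \in eta v); last by right.
  have /forallP/(_ v)/implyP/(_ uv)/forallP/(_ k)/forallP/(_ k) := eG u.
  by rewrite ku kv /K eqxx.
exists [ffun v => [set k | M v k != 0]%SET].
  apply/andP; split; last first.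
    apply/forallP => u; apply/forallP => v; apply/implyP => uv.
    apply/forallP => a; apply/forallP => b; rewrite !ffunE !inE.
    apply/implyP => /andP[Ma Mb]; apply/eqP => ab.
    by have [e|e] := MG u v uv a; [rewrite e eqxx in Ma|rewrite -ab e eqxx in Mb].
  apply/forallP => v; rewrite ffunE; apply/eqP => e.
  have [_] := Ms v; rewrite big1 => [/esym/eqP|k _]; first by rewrite oner_eq0.
  by apply/eqP; have := in_set0 k; rewrite -e inE => /negbFE.
move=> v; have [M0 M1] := Ms v; split=> //; split=> // k.
by rewrite ffunE inE negbK => /eqP.
Qed.

Definition vertex f : 'M[R]_(n, 3) := \matrix_(v, k) (k == f v)%:R.

Lemma vertex_stochastic f : stochastic (vertex f).
Proof.
move=> v; split=> [k|]; first by rewrite mxE ler0n.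
under eq_bigr do rewrite mxE.
by rewrite (bigD1 (f v)) //= eqxx big1 ?addr0 // => k /negPf->.
Qed.

Lemma vertex_disjoint f M u v :
  M v (f u) = 0 -> forall k, vertex f u k = 0 \/ M v k = 0.
Proof. by move=> Mv k; rewrite mxE; case: eqP => [->|_]; [right|left]. Qed.

Lemma vertexX f : compat G f f -> X (vertex f).
Proof.
move=> ff; apply/Hom_spaceP; split; first exact: vertex_stochastic.
by move=> u v uv; apply: vertex_disjoint; rewrite mxE (negPf (ff _ _ uv)).
Qed.

(** Colors picked in the supports of a single point belong to the cell of that point. *)
Lemma support_compat M f g : X M -> (forall v, M v (f v) != 0) ->
  (forall v, M v (g v) != 0) -> compat G f g.
Proof.
move=> /Hom_spaceP[_ MG] Mf Mg u v uv; apply/eqP => e.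
have [h|h] := MG u v uv (f u); first by have := Mf u; rewrite h eqxx.
by have := Mg v; rewrite -e h eqxx.
Qed.

Lemma vertex_support f g : (forall v, vertex f v (g v) != 0) -> g = f.
Proof.
move=> h; apply/ffunP => v; have := h v; rewrite mxE.
by case: (g v =P f v) => // _ /eqP; case.
Qed.

(** Three entries with sum 1 cannot all be below 1/3. A color of mass at least 1/3 stays in the
    support under any change smaller than 1/3. *)
Lemma exists_support M : X M -> exists f, forall v, 3^-1 <= M v (f v).
Proof.
move=> /Hom_spaceP[Ms _].
have /boolp.choice[f Hf] v : exists k, 3^-1 <= M v k.
  apply: contrapT => h; have [_ M1] := Ms v.
  have : \sum_k M v k < \sum_(k < 3) 3^-1.
    apply: ltr_sum => [|k _]; first by apply/hasP; exists ord0; rewrite ?mem_index_enum.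
    by rewrite ltNge; apply/negP => hk; apply: h; exists k.
  by rewrite M1 sumr_const card_ord -[_ *+ 3]mulr_natl divff ?ltxx.
by exists (finfun f) => v; rewrite ffunE.
Qed.

(* Paths with globally continuous entries: these can be concatenated by adding them. *)
Definition entry_path M N := exists g : R -> 'M[R]_(n, 3),
  [/\ forall i j, continuous (fun t => g t i j), g 0 = M, g 1 = N &
      forall t, 0 <= t <= 1 -> X (g t)].

(** Truncation to [0, 1], written with absolute values so that its continuity is that of the
    norm. *)
Definition clamp (t : R) : R := (`|t| - `|t - 1| + 1) / 2.

Lemma clamp_le0 t : t <= 0 -> clamp t = 0.
Proof. by move=> t0; rewrite /clamp !ler0_norm; lra. Qed.

Lemma clamp_ge1 t : 1 <= t -> clamp t = 1.
Proof. by move=> t1; rewrite /clamp !ger0_norm; lra. Qed.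

Lemma clamp_id t : 0 <= t <= 1 -> clamp t = t.
Proof. by move=> /andP[t0 t1]; rewrite /clamp ger0_norm // ler0_norm; lra. Qed.

Lemma continuous_affine (a b : R) : continuous (fun t : R => a * t + b).
Proof.
move=> t; apply: cvgD; last exact: cvg_cst.
by apply: cvgM; [exact: cvg_cst|exact: cvg_id].
Qed.

Lemma continuous_clamp : continuous clamp.
Proof.
move=> t; apply: cvgM; last exact: cvg_cst.
apply: cvgD; last exact: cvg_cst.
apply: cvgB; first by apply: cvg_norm; exact: cvg_id.
by apply: cvg_norm; apply: cvgB; [exact: cvg_id|exact: cvg_cst].
Qed.

Definition clamp_affine (a b t : R) : R := clamp (a * t + b).

Lemma continuous_clamp_affine a b : continuous (clamp_affine a b).
Proof.
move=> t; apply: (@continuous_comp _ _ _ (fun t => a * t + b) clamp).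
  exact: continuous_affine.
exact: continuous_clamp.
Qed.

Lemma continuous_mx (T : topologicalType) (g : T -> 'M[R]_(n, 3)) :
  (forall i j, continuous (fun t => g t i j)) -> continuous g.
Proof.
move=> gc t A [P gP PA].
have : \forall t' \near t, forall i j, P i j (g t' i j).
  by apply: filter_forall => i; apply: filter_forall => j; apply: gc; apply: gP.
by apply: filterS => t' h; apply: PA.
Qed.

Lemma path_in_entry_path M N : entry_path M N -> path_in (R:=R) X M N.
Proof.
case=> g [gc g0 g1 gX]; exists g; split=> //.
  by apply: continuous_subspaceT; apply: continuous_mx.
by move=> _ [t + <-]; rewrite /= in_itv /=; apply: gX.
Qed.

Lemma entry_path_trans M N L : entry_path M N -> entry_path N L -> entry_path M L.
Proof.
case=> g [gc g0 g1 gX] [h [hc h0 h1 hX]].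
(* On each half of the interval one of the two terms rests at [N], and subtracting [N] leaves the
   moving one. *)
pose k t := g (clamp (2 * t)) + h (clamp (2 * t - 1)) - N.
have kl t : t <= 2^-1 -> k t = g (clamp (2 * t)).
  move=> th; have t0 : 2 * t - 1 <= 0 by lra.
  by rewrite /k (clamp_le0 t0) h0 addrK.
have kr t : 2^-1 <= t -> k t = h (clamp (2 * t - 1)).
  move=> th; have t1 : 1 <= 2 * t by lra.
  by rewrite /k (clamp_ge1 t1) g1 [N + _]addrC addrK.
exists k; split.
- move=> i j.
  rewrite (_ : (fun t => _) = (fun t => ((fun s => g s i j) \o clamp_affine 2 0) t +
     ((fun s => h s i j) \o clamp_affine 2 (-1)) t - N i j)); last first.
    by apply/funext => s; rewrite /k /clamp_affine /= !mxE addr0.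
  move=> t; apply: cvgB; last exact: cvg_cst.
  by apply: cvgD; apply: continuous_comp;
    [exact: continuous_clamp_affine|exact: gc|exact: continuous_clamp_affine|exact: hc].
- by rewrite kl ?clamp_le0 ?g0 //; lra.
- by rewrite kr ?clamp_ge1 ?h1 //; lra.
move=> t /andP[t0 t1]; have [th|/ltW th] := leP t 2^-1.
  by rewrite kl // clamp_id; [apply: gX; lra|lra].
by rewrite kr // clamp_id; [apply: hX; lra|lra].
Qed.

(** The hypothesis makes the row-wise union of the supports a cell, and closed cells are convex. *)
Lemma segmentX M N t : X M -> X N ->
  (forall u v, G u v -> forall k, M u k = 0 \/ N v k = 0) -> 0 <= t <= 1 ->
  X (M + t *: (N - M)).
Proof.
move=> /Hom_spaceP[Ms MG] /Hom_spaceP[Ns NG] MN /andP[t0 t1].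
apply/Hom_spaceP; split=> [v|u v uv k].
  have [M0 M1] := Ms v; have [N0 N1] := Ns v; split=> [k|].
    by rewrite !mxE; have := M0 k; have := N0 k; nra.
  under eq_bigr do rewrite !mxE.
  by rewrite big_split /= -mulr_sumr sumrB M1 N1; ring.
rewrite !mxE; have vu : G v u by rewrite Gsym.
have {}MN' := MN v u vu k; have {}MN := MN u v uv k.
have {}MG := MG u v uv k; have {}NG := NG u v uv k.
have [Nv|Nv] := eqVneq (N v k) 0; have [Mv|Mv] := eqVneq (M v k) 0.
- by right; rewrite Nv Mv; ring.
- left; case: MG => [->|/eqP]; last by rewrite (negPf Mv).
  by case: MN' => [/eqP|->]; [rewrite (negPf Mv)|ring].
- left; case: NG => [->|/eqP]; last by rewrite (negPf Nv).
  by case: MN => [->|/eqP]; [ring|rewrite (negPf Nv)].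
left; case: NG => [->|/eqP]; last by rewrite (negPf Nv).
by case: MN => [->|/eqP]; [ring|rewrite (negPf Nv)].
Qed.

Lemma segment_path M N : X M -> X N ->
  (forall u v, G u v -> forall k, M u k = 0 \/ N v k = 0) -> entry_path M N.
Proof.
move=> MX NX MN; exists (fun t => M + t *: (N - M)); split.
- move=> i j; rewrite (_ : (fun t => _) = (fun t => (N i j - M i j) * t + M i j)).
    exact: continuous_affine.
  by apply/funext => t; rewrite !mxE addrC mulrC.
- by rewrite scale0r addr0.
- by rewrite scale1r addrC subrK.
by move=> t; apply: segmentX.
Qed.

Lemma compat_recolor g z a : irreflexive G -> compat G g g ->
  compat G (recolor g z a) (recolor g z a) -> compat G g (recolor g z a).
Proof.
move=> Girr gg rr u v uv; have [vz|vz] := eqVneq v z; last first.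
  by rewrite ffunE (negPf vz); apply: gg.
have := rr u v uv; rewrite [recolor g z a u]ffunE ifN //.
by rewrite -vz; apply: contraTneq uv => ->; rewrite Girr.
Qed.

Lemma reach_entry_path f g : irreflexive G -> compat G f f -> reach G setT f g ->
  entry_path (vertex f) (vertex g).
Proof.
move=> Girr ff r; suff [] : compat G g g /\ entry_path (vertex f) (vertex g) by [].
elim: r => [|{}g z a _ [gg IH] Hg].
  split=> //; exists (fun=> vertex f); split=> // [i j|t _].
    exact: cst_continuous.
  exact: vertexX.
have rr : compat G (recolor g z a) (recolor g z a) by move=> u v; apply: Hg; rewrite inE.
split=> //; apply: entry_path_trans IH _; apply: segment_path => [||u v uv].
- exact: vertexX.
- exact: vertexX.
by apply: vertex_disjoint; rewrite mxE (negPf (compat_recolor Girr gg rr uv)).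
Qed.

Lemma zero_connectedX :
  (forall m (x : {ffun 'I_m.+3 -> 'I_n}), cycle_in G x -> m = 1%N) ->
  irreflexive G -> zero_connected (R := R) X.
Proof.
move=> cycles4 Girr; split.
  have [f Hf] := bipartite Gsym Girr cycles4.
  exists (vertex [ffun v => if f v then 0 else 1]); apply: vertexX => u v uv.
  by rewrite !ffunE; have := Hf u v uv; case: (f u); case: (f v).
move=> M N MX NX; apply: path_in_entry_path.
have [f Mf] := exists_support MX; have [g Ng] := exists_support NX.
have nz (x : R) : 3^-1 <= x -> x != 0 by move=> x3; rewrite gt_eqF //; lra.
have ff : compat G f f by apply: (support_compat MX) => v; apply: nz.
have gg : compat G g g by apply: (support_compat NX) => v; apply: nz.
have fX := vertexX ff; have gX := vertexX gg.
have disj M' h : X M' -> (forall v, 3^-1 <= M' v (h v)) ->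
    forall u v, G u v -> M' v (h u) = 0.
  move=> /Hom_spaceP[_ M'G] M'h u v uv.
  have [|//] := M'G u v uv (h u); have := nz _ (M'h u).
  by move=> /negPf /eqP.
apply: entry_path_trans (_ : entry_path M (vertex f)) _.
  apply: segment_path => // u v uv k; apply/or_comm.
  by apply: (vertex_disjoint (M := M)); apply: (disj _ _ MX Mf); rewrite Gsym.
apply: entry_path_trans (_ : entry_path (vertex f) (vertex g)) _.
  apply: reach_entry_path => //; apply: (recolor_connected Gsym Girr) => //.
    by move=> u v _ _; apply: ff.
  by move=> u v _ _; apply: gg.
apply: segment_path => // u v uv.
by apply: vertex_disjoint; apply: (disj _ _ NX Ng).
Qed.

(** The path is sampled so finely that entries change by less than 1/3 per step. Colors picked at
    one sample are then in the support at the previous one, so consecutive colorings are compatible.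
    At the two ends the support leaves no choice. *)
Lemma path_winding m (x : {ffun 'I_m.+3 -> 'I_n}) f g : cycle_in G x ->
  path_in (R:=R) X (vertex f) (vertex g) -> winding x f = winding x g.
Proof.
move=> cx [h [hc h0 h1 hX]].
have [d d0 Hd] : exists2 d : R, 0 < d & forall s t : R, `[0, 1]%classic s ->
    `[0, 1]%classic t -> ball s d t -> forall i j, `|h s i j - h t i j| < 3^-1.
  have e0 : 0 < 3^-1 :> R by lra.
  exact: (uniform_continuity (@segment_compact R 0 1) hc e0).
pose N := (Num.truncn d^-1).+1.
have N0 : 0 < N%:R :> R by rewrite ltr0n.
have dN : N%:R^-1 < d.
  by rewrite -[d]invrK ltf_pV2 ?posrE ?invr_gt0 // truncnS_gt.
have I i : (i <= N)%N -> `[0, 1]%classic (i%:R / N%:R : R).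
  move=> iN; rewrite /= in_itv /= divr_ge0 //=.
  by rewrite ler_pdivrMr // mul1r ler_nat.
have hXi i : (i <= N)%N -> X (h (i%:R / N%:R)).
  by move=> iN; apply: hX; exists (i%:R / N%:R) => //; apply: I.
have /boolp.choice[c Hc] i : exists c : {ffun 'I_n -> 'I_3}, (i <= N)%N ->
    forall v, 3^-1 <= h (i%:R / N%:R) v (c v).
  have [iN|iN] := leqP i N; last by exists f.
  by have [c Hc] := exists_support (hXi i iN); exists c.
have nz (y : R) : 3^-1 <= y -> y != 0 by move=> x3; rewrite gt_eqF //; lra.
have cc i : (i <= N)%N -> compat G (c i) (c i).
  by move=> iN; apply: (support_compat (hXi _ iN)) => v; apply/nz/Hc.
have step i : (i < N)%N -> winding x (c i) = winding x (c i.+1).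
  move=> iN; apply: (winding_compat Gsym cx); [exact/cc/ltnW|exact: cc|].
  apply: (support_compat (hXi _ iN)) => v; last exact/nz/Hc.
  have bi : ball (i%:R / N%:R : R) d (i.+1%:R / N%:R).
    by rewrite /ball /= distrC -mulrBl -natrB // subSnn mul1r gtr0_norm ?invr_gt0.
  have := Hd _ _ (I i (ltnW iN)) (I i.+1 iN) bi v (c i v).
  have := Hc i (ltnW iN) v; rewrite ltr_norml => h1' /andP[h2 h3].
  by rewrite gt_eqF //; lra.
have cN i : (i <= N)%N -> winding x (c i) = winding x (c 0%N).
  by elim: i => // i IH iN; rewrite -step // IH // ltnW.
have -> : f = c 0%N.
  apply/esym/vertex_support => v; apply: nz.
  by have := Hc 0%N isT v; rewrite mul0r h0.
have -> : g = c N; last by rewrite cN.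
apply/esym/vertex_support => v; apply: nz.
by have := Hc N (leqnn N) v; rewrite divff ?h1 // gt_eqF.
Qed.

End HomSpace.

(** * A loop in Hom(G, K_3) that is not contractible *)

(** The vertices of Hom(K_2, K_3) in cyclic order: the second and the first color advance
    alternately, and index 6 returns to index 0. *)
Definition hexagon (q : nat) : 'I_3 * 'I_3 := ((q./2)%:R, (uphalf q).+1%:R).

Lemma hexagon_box q (x y : 'I_3 * 'I_3) : (q < 6)%N ->
  (x.1 = (hexagon q).1 \/ x.1 = (hexagon q.+1).1) ->
  (x.2 = (hexagon q).2 \/ x.2 = (hexagon q.+1).2) ->
  (y.1 = (hexagon q).1 \/ y.1 = (hexagon q.+1).1) ->
  (y.2 = (hexagon q).2 \/ y.2 = (hexagon q.+1).2) ->
  disjoint_colors x y.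
Proof.
rewrite /disjoint_colors.
by case: q => [|[|[|[|[|[|//]]]]]] _ [] -> [] -> [] -> [] ->.
Qed.

Lemma turn2_xx x : turn2 x x = 0.
Proof. by rewrite /turn2 !turn_xx. Qed.

Lemma turn2_hexagon q : (q < 6)%N -> turn2 (hexagon q) (hexagon q.+1) = 1.
Proof. by case: q => [|[|[|[|[|[|//]]]]]]. Qed.

(** Along one edge of the hexagon all sampled pairs lie in one cell, so [turn2] adds up to its value
    1 between the ends of the edge. *)
Lemma hexagon_turns (N1 : nat) (phi : nat -> 'I_3 * 'I_3) :
  (forall q r, (q < 6)%N -> (r <= N1)%N ->
    ((phi (q * N1 + r)%N).1 = (hexagon q).1 \/
     (phi (q * N1 + r)%N).1 = (hexagon q.+1).1) /\
    ((phi (q * N1 + r)%N).2 = (hexagon q).2 \/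
     (phi (q * N1 + r)%N).2 = (hexagon q.+1).2)) ->
  (forall q, (q <= 6)%N -> phi (q * N1)%N = hexagon q) ->
  \sum_(i < 6 * N1) turn2 (phi i) (phi i.+1) = 6.
Proof.
move=> box vert.
pose S i := \sum_(k < i) turn2 (phi k) (phi k.+1).
have S1 q : (q <= 6)%N -> S (q * N1)%N = q%:Z.
  elim: q => [_|q IH q6]; first by rewrite mul0n /S big_ord0.
  have Sr r : (r <= N1)%N -> S (q * N1 + r)%N = q%:Z + turn2 (hexagon q) (phi (q * N1 + r)%N).
    elim: r => [_|r IHr rN]; first by rewrite addn0 IH 1?ltnW // vert 1?ltnW // turn2_xx addr0.
    rewrite addnS /S big_ord_recr /= -/(S _) IHr 1?ltnW // -addrA; congr (_ + _).
    have [b1 b2] := box q r q6 (ltnW rN); have [b3 b4] := box q r.+1 q6 rN.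
    rewrite addnS in b3 b4.
    by apply: turn2_add; apply: (hexagon_box q6) => //; left.
  rewrite mulSn addnC Sr // addnC -mulSn vert // turn2_hexagon //; lia.
exact: S1.
Qed.

Lemma sum_ord_telescope (V : zmodType) (F : nat -> V) N :
  \sum_(i < N) (F i - F i.+1) = F 0%N - F N.
Proof.
elim: N => [|N IH]; first by rewrite big_ord0 subrr.
by rewrite big_ord_recr /= IH addrA subrK.
Qed.

(** The corners of a grid square lie in one cell, so [turn2] has the same sum along both routes
    across it. With constant vertical sides all rows have equal sums, and the top row is
    constant. *)
Lemma discrete_stokes (N : nat) (phi : nat -> nat -> 'I_3 * 'I_3) e :
  (forall i j a b c d, (i < N)%N -> (j < N)%N -> (a <= 1)%N -> (b <= 1)%N ->
     (c <= 1)%N -> (d <= 1)%N ->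
     disjoint_colors (phi (i + a)%N (j + b)%N) (phi (i + c)%N (j + d)%N)) ->
  (forall j, (j <= N)%N -> phi 0%N j = e /\ phi N j = e) ->
  (forall i, (i <= N)%N -> phi i N = e) ->
  \sum_(i < N) turn2 (phi i 0%N) (phi i.+1 0%N) = 0.
Proof.
move=> dc sides top.
pose W j := \sum_(i < N) turn2 (phi i j) (phi i.+1 j).
have WS j : (j < N)%N -> W j = W j.+1.
  move=> jN; apply/eqP; rewrite -subr_eq0 -sumrB.
  rewrite (eq_bigr (fun i : 'I_N => turn2 (phi i j) (phi i j.+1) -
      turn2 (phi i.+1 j) (phi i.+1 j.+1))) => [|i _].
    rewrite (sum_ord_telescope (fun i => turn2 (phi i j) (phi i j.+1))).
    have [-> ->] := sides j (ltnW jN); have [-> ->] := sides j.+1 jN.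
    by rewrite subrr.
  have dc' := dc i j _ _ _ _ (ltn_ord i) jN.
  have h a b c d : (a <= 1)%N -> (b <= 1)%N -> (c <= 1)%N -> (d <= 1)%N ->
    disjoint_colors (phi (i + a)%N (j + b)%N) (phi (i + c)%N (j + d)%N).
    by move=> *; apply: dc'.
  have := @turn2_add (phi i j) (phi i.+1 j) (phi i.+1 j.+1).
  have := @turn2_add (phi i j) (phi i j.+1) (phi i.+1 j.+1).
  have h00 := h 0%N 0%N; have h10 := h 1%N 0%N; have h01 := h 0%N 1%N; have h11 := h 1%N 1%N.
  rewrite !addn0 !addn1 in h00 h10 h01 h11.
  have h1 := h00 0%N 0%N; have h2 := h00 1%N 0%N; have h3 := h00 0%N 1%N.
  have h4 := h00 1%N 1%N; have h5 := h10 1%N 0%N; have h6 := h10 1%N 1%N.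
  have h7 := h01 0%N 1%N; have h8 := h01 1%N 1%N; have h9 := h11 1%N 1%N.
  rewrite ?addn0 ?addn1 in h1 h2 h3 h4 h5 h6 h7 h8 h9.
  rewrite ?h1 ?h2 ?h3 ?h4 ?h5 ?h6 ?h7 ?h8 ?h9 //.
  move=> /(_ isT isT isT isT isT isT) e1 /(_ isT isT isT isT isT isT) e2.
  by apply/eqP; rewrite subr_eq addrAC eq_sym subr_eq e1 -e2.
have W0 j : (j <= N)%N -> W 0%N = W j.
  by elim: j => // j IH jN; rewrite -WS // IH // ltnW.
rewrite -/(W 0%N) (W0 N) // /W big1 // => i _.
by rewrite !top ?turn2_xx // ltnW.
Qed.

(** * Piecewise linear paths *)

Section Polygon.
Variables (R : realType) (n : nat).
Implicit Types (V : nat -> 'M[R]_(n, 3)).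

(** The piecewise linear path through [V 0], ..., [V L] on [0, L]; as a sum of clamped increments it
    is continuous without gluing. *)
Definition polygon L V (t : R) : 'M[R]_(n, 3) :=
  V 0%N + \sum_(j < L) clamp (t - j%:R) *: (V j.+1 - V j).

Lemma polygonE L V q t : (q < L)%N -> q%:R <= t <= q.+1%:R ->
  polygon L V t = V q + (t - q%:R) *: (V q.+1 - V q).
Proof.
move=> qL /andP[qt tq]; rewrite /polygon.
rewrite -(big_mkord xpredT (fun j => clamp (t - j%:R) *: (V j.+1 - V j))).
rewrite (big_cat_nat _ (n := q)) //=; last exact: ltnW.
rewrite big_nat (eq_bigr (fun j => V j.+1 - V j)) => [|j /= jq]; last first.
  rewrite clamp_ge1 ?scale1r // lerBrDl (le_trans _ qt) // natr1 ler_nat.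
  exact: jq.
rewrite -big_nat telescope_sumr // big_ltn // big_nat big1 => [|j /andP[qj _]]; last first.
  rewrite clamp_le0 ?scale0r // subr_le0 (le_trans tq) // ler_nat.
  exact: qj.
rewrite addr0 addrA addrCA subrr addr0 clamp_id // subr_ge0 qt /=.
by rewrite lerBlDl natr1.
Qed.

Lemma continuous_sum_ord (F : nat -> R -> R) L :
  (forall k, continuous (F k)) -> continuous (fun t => \sum_(k < L) F k t).
Proof.
move=> Fc; elim: L => [|L IH].
  rewrite (_ : (fun t => _) = fun=> 0); first exact: cst_continuous.
  by apply/funext => t; rewrite big_ord0.
rewrite (_ : (fun t => _) = fun t => \sum_(k < L) F k t + F L t).
  by move=> t; apply: cvgD; [exact: IH|exact: Fc].
by apply/funext => t; rewrite big_ord_recr.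
Qed.

Lemma continuous_polygon L V i j :
  continuous (fun t : R => polygon L V (L%:R * t) i j).
Proof.
rewrite (_ : (fun t : R => _) = (fun t : R => V 0%N i j +
    \sum_(k < L) clamp_affine L%:R (- k%:R) t * (V k.+1 - V k) i j)).
  move=> t; apply: cvgD; first exact: cvg_cst.
  apply: (@continuous_sum_ord (fun k t => clamp_affine L%:R (- k%:R) t *
    (V k.+1 - V k) i j)) => k s.
  by apply: cvgM; [exact: continuous_clamp_affine|exact: cvg_cst].
apply/funext => t; rewrite /polygon !mxE summxE; congr (_ + _).
by apply: eq_bigr => k _; rewrite !mxE.
Qed.

End Polygon.

Section Loop.
Variables (R : realType) (n : nat) (G : rel 'I_n) (side : 'I_n -> bool) (u0 v0 : 'I_n).
Hypotheses (Gsym : symmetric G) (sideG : forall u v, G u v -> side u != side v).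
Hypothesis uv0 : G u0 v0.
Notation X := (Hom_space (R:=R) G (K 3)).

(** Pullback of a hexagon vertex along the bipartition; its restriction to the edge [u0], [v0] is
    that hexagon vertex again. *)
Definition hexagon_coloring q : {ffun 'I_n -> 'I_3} :=
  [ffun v => if side v == side u0 then (hexagon q).1 else (hexagon q).2].

Let Vq q := vertex R (hexagon_coloring q).
Let loop (t : R) := polygon 6 Vq (6 * t).

Let hexagon_compat q a b : (q < 6)%N -> (a <= 1)%N -> (b <= 1)%N ->
  compat G (hexagon_coloring (q + a)) (hexagon_coloring (q + b)).
Proof.
move=> q6 a1 b1 u v uv; rewrite !ffunE.
have : disjoint_colors (hexagon (q + a)) (hexagon (q + b)).
  case: a b a1 b1 => [|[|//]] [|[|//]] _ _; rewrite ?addn0 ?addn1;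
    by apply: (hexagon_box q6); auto.
have := sideG uv; rewrite /disjoint_colors.
by case: (side u) (side v) (side u0) => [] [] [] //= _ /andP[h1 h2] //;
  rewrite eq_sym.
Qed.

Let VX q : (q <= 6)%N -> X (Vq q).
Proof.
case: q => [_|q q6]; apply: vertexX.
  by have := @hexagon_compat 0 0 0 isT isT isT.
by have := @hexagon_compat q 1 1 q6 isT isT; rewrite addn1.
Qed.

Let loop_segment q t : (q < 6)%N -> q%:R <= 6 * t <= q.+1%:R ->
  loop t = Vq q + (6 * t - q%:R) *: (Vq q.+1 - Vq q).
Proof. exact: polygonE. Qed.

Lemma find_segment (t : R) : 0 <= t <= 1 ->
  exists2 q, (q < 6)%N & q%:R <= 6 * t <= q.+1%:R.
Proof.
move=> /andP[t0 t1].
have [h|h] := leP (6 * t) 1; first by exists 0%N => //; lra.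
have [h2|h2] := leP (6 * t) 2; first by exists 1%N => //; lra.
have [h3|h3] := leP (6 * t) 3; first by exists 2%N => //; lra.
have [h4|h4] := leP (6 * t) 4; first by exists 3%N => //; lra.
have [h5|h5] := leP (6 * t) 5; first by exists 4%N => //; lra.
by exists 5%N => //; lra.
Qed.

Let loopX t : 0 <= t <= 1 -> X (loop t).
Proof.
move=> /find_segment[q q6 qt]; rewrite (loop_segment q6 qt).
have c01 := hexagon_compat q6 (a := 0) (b := 1) isT isT.
rewrite addn0 addn1 in c01.
apply: segmentX => //; [exact/VX/ltnW|exact: VX| |].
  by move=> u v uv; apply: vertex_disjoint; rewrite mxE (negPf (c01 _ _ uv)).
by move: qt; lra.
Qed.

Let loop_support q t v k : (q < 6)%N -> q%:R <= 6 * t <= q.+1%:R ->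
  loop t v k != 0 -> k = hexagon_coloring q v \/ k = hexagon_coloring q.+1 v.
Proof.
move=> q6 qt; rewrite (loop_segment q6 qt) !mxE.
case: (k =P hexagon_coloring q v) => [->|_]; first by left.
case: (k =P hexagon_coloring q.+1 v) => [->|_]; first by right.
by rewrite mulr0n subrr mulr0 addr0 eqxx.
Qed.

Let loop_vertex q : (q <= 6)%N -> loop (q%:R / 6) = Vq q.
Proof.
have e p : 6 * (p%:R / 6) = p%:R :> R by field.
case: q => [_|q q6].
  rewrite (loop_segment (q := 0)) // e ?subrr ?scale0r ?addr0 //.
  by rewrite lexx ler01.
rewrite (loop_segment q6) e; last by rewrite lexx andbT ler_nat.
by rewrite -[q.+1%:R]natr1 addrAC subrr add0r scale1r addrC subrK.
Qed.

(** A contraction sampled on a grid assigns to each grid point a pair of colors on the edge [u0],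
    [v0]. The bottom row then has sum 0 by the Stokes argument, but 6 because it follows the
    loop. *)
Lemma not_one_connectedX : ~ one_connected (R := R) X.
Proof.
have V60 : Vq 6 = Vq 0.
  by congr vertex; apply/ffunP => v; rewrite !ffunE /hexagon; case: ifP => _; apply/val_inj.
have l0 : loop 0 = Vq 0 by rewrite -(loop_vertex (q := 0)) // mul0r.
have l1 : loop 1 = Vq 0 by rewrite -V60 -(loop_vertex (q := 6)) // divff.
move=> [_ /(_ (Vq 0) loop (VX (q := 0) isT) _ l0 l1)] [].
- apply: continuous_subspaceT; apply: continuous_mx => i j.
  exact: continuous_polygon.
- by move=> _ [t + <-]; rewrite /= in_itv /=; apply: loopX.
move=> H [Hc HX Hbot Hside].
have [d d0 Hd] : exists2 d : R, 0 < d & forall s t : R * R,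
    (`[0, 1] `*` `[0, 1])%classic s -> (`[0, 1] `*` `[0, 1])%classic t ->
    ball s d t -> forall i j, `|H s i j - H t i j| < 3^-1.
  have e0 : 0 < 3^-1 :> R by lra.
  apply: (uniform_continuity _ Hc e0).
  by apply: compact_setX; apply: segment_compact.
(* A grid size divisible by 6 puts the six vertices of the loop on grid points. *)
pose N1 := (Num.truncn d^-1).+1; pose N := (6 * N1)%N.
have N10 : 0 < N1%:R :> R by rewrite ltr0n.
have N0 : 0 < N%:R :> R by rewrite ltr0n.
have dN : N%:R^-1 < d.
  rewrite -[d]invrK ltf_pV2 ?posrE ?invr_gt0 //.
  apply: lt_le_trans (truncnS_gt _) _; by rewrite ler_nat /N leq_pmull.
have I i : (i <= N)%N -> 0 <= (i%:R / N%:R : R) <= 1.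
  by move=> iN; rewrite divr_ge0 //= ler_pdivrMr // mul1r ler_nat.
pose z i j : R * R := (i%:R / N%:R, j%:R / N%:R).
have zS i j : (i <= N)%N -> (j <= N)%N -> (`[0, 1] `*` `[0, 1])%classic (z i j).
  by move=> iN jN; split; rewrite /= in_itv /= I.
have HzX i j : (i <= N)%N -> (j <= N)%N -> X (H (z i j)).
  by move=> iN jN; apply: HX; exists (z i j) => //; apply: zS.
have /boolp.choice[c Hc'] (ij : nat * nat) : exists c : {ffun 'I_n -> 'I_3},
    (ij.1 <= N)%N -> (ij.2 <= N)%N -> forall v, 3^-1 <= H (z ij.1 ij.2) v (c v).
  have [iN|iN] := leqP ij.1 N; last by exists [ffun=> 0].
  have [jN|jN] := leqP ij.2 N; last by exists [ffun=> 0].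
  by have [c Hc'] := exists_support (HzX _ _ iN jN); exists c.
have nz (y : R) : 3^-1 <= y -> y != 0 by move=> x3; rewrite gt_eqF //; lra.
have cz i j : (i <= N)%N -> (j <= N)%N -> forall v, H (z i j) v (c (i, j) v) != 0.
  by move=> iN jN v; apply/nz/(Hc' (i, j)).
pose phi i j := (c (i, j) u0, c (i, j) v0).
(* The colors picked at all four corners of a square lie in the support at its corner [z i j], hence
   in one cell. *)
have nb i j a b : (i < N)%N -> (j < N)%N -> (a <= 1)%N -> (b <= 1)%N ->
    forall v, H (z i j) v (c ((i + a)%N, (j + b)%N) v) != 0.
  move=> iN jN a1 b1 v.
  have iaN : (i + a <= N)%N by lia.
  have jbN : (j + b <= N)%N by lia.
  have close k l : (l <= 1)%N -> `|k%:R / N%:R - (k + l)%N%:R / N%:R| < d :> R.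
    move=> l1'; rewrite -mulrBl natrD opprD addrA subrr add0r mulNr normrN.
    rewrite ger0_norm ?divr_ge0 //; apply: le_lt_trans dN.
    by rewrite ler_piMl ?invr_ge0 // ?lern1 // ltW.
  have bz : ball (z i j) d (z (i + a)%N (j + b)%N) by split; apply: close.
  have := Hd _ _ (zS i j (ltnW iN) (ltnW jN)) (zS _ _ iaN jbN) bz v (c ((i + a)%N, (j + b)%N) v).
  have := Hc' ((i + a)%N, (j + b)%N) iaN jbN v; rewrite /= ltr_norml => h1 /andP[h2 h3].
  by rewrite gt_eqF //; lra.
have bot i : (i <= N)%N -> H (z i 0%N) = loop (i%:R / N%:R).
  move=> iN; have [] := Hbot (i%:R / N%:R); last by rewrite /z mul0r.
  by rewrite in_itv /= I.
have phiV i j q : (i <= N)%N -> (j <= N)%N -> H (z i j) = Vq q -> phi i j = hexagon q.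
  move=> iN jN e; have := cz i j iN jN; rewrite e => /vertex_support cE.
  rewrite /phi cE !ffunE eqxx; have := sideG uv0; rewrite eq_sym => /negPf->.
  by case: (hexagon q).
have NN : N%:R / N%:R = 1 :> R by rewrite divff // gt_eqF.
have top i : (i <= N)%N -> H (z i N) = Vq 0.
  move=> iN; have [] := Hbot (i%:R / N%:R); last by rewrite /z NN.
  by rewrite in_itv /= I.
have sides j : (j <= N)%N -> H (z 0%N j) = Vq 0 /\ H (z N j) = Vq 0.
  move=> jN; have [] := Hside (j%:R / N%:R); last by rewrite /z NN mul0r.
  by rewrite in_itv /= I.
have S0 : \sum_(i < N) turn2 (phi i 0%N) (phi i.+1 0%N) = 0.
  apply: (discrete_stokes (e := hexagon 0)) => [i j a b a' b' iN jN a1 b1 a1' b1'|j jN|i iN].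
  - have iN' := ltnW iN; have jN' := ltnW jN.
    have vu0 : G v0 u0 by rewrite Gsym.
    have cc := support_compat (HzX _ _ iN' jN') (nb _ _ _ _ iN jN a1 b1) (nb _ _ _ _ iN jN a1' b1').
    by rewrite /disjoint_colors /= cc //= eq_sym cc.
  - have [h1 h2] := sides j jN.
    by split; apply: phiV.
  - by apply: phiV => //; apply: top.
have S6 : \sum_(i < N) turn2 (phi i 0%N) (phi i.+1 0%N) = 6.
  have E q r : (q * N1 + r)%N%:R / N%:R * 6 = q%:R + r%:R / N1%:R :> R.
    by rewrite /N natrM natrD natrM; field; rewrite gt_eqF.
  apply: (hexagon_turns (phi := fun i => phi i 0%N)) => [q r q6 rN1|q q6].
    have iN : (q * N1 + r <= N)%N by rewrite /N; nia.
    have qt : q%:R <= 6 * ((q * N1 + r)%N%:R / N%:R : R) <= q.+1%:R.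
      rewrite [6 * _]mulrC E lerDl divr_ge0 //= -natr1 lerD2l ler_pdivrMr //.
      by rewrite mul1r ler_nat.
    have key v : c ((q * N1 + r)%N, 0%N) v = hexagon_coloring q v \/
        c ((q * N1 + r)%N, 0%N) v = hexagon_coloring q.+1 v.
      by apply: (loop_support q6 qt); rewrite -bot //; apply: cz.
    have := key u0; have := key v0; rewrite !ffunE eqxx.
    by have := sideG uv0; rewrite eq_sym => /negPf->.
  have iN : (q * N1 <= N)%N by rewrite /N leq_mul2r q6 orbT.
  apply: phiV => //; rewrite bot // -loop_vertex //; congr loop.
  by have := E q 0%N; rewrite addn0 mul0r addr0 => <-; field; rewrite gt_eqF.
by move: S6; rewrite S0.
Qed.

End Loop.

Local Close Scope classical_set_scope.

(** * Bounds on the probabilities *)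

Lemma graph_of_sym n (E : {set {set 'I_n}}) : symmetric (graph_of E).
Proof. by move=> x y; rewrite /graph_of eq_sym setUC. Qed.

Lemma graph_of_irr n (E : {set {set 'I_n}}) : irreflexive (graph_of E).
Proof. by move=> x; rewrite /graph_of eqxx. Qed.

Section Deterministic.
Variables (R : realType) (n : nat) (E : {set {set 'I_n}}).
Notation G := (graph_of E).
Notation X := (Hom_space (R:=R) G (K 3)).

Lemma conn_eq_0_graph u v :
  (forall m (x : {ffun 'I_m.+3 -> 'I_n}), cycle_in G x -> m = 1%N) ->
  G u v -> conn_eq_0 (R:=R) X.
Proof.
move=> cycles4 uv; have Gs := graph_of_sym E; have Gi := graph_of_irr E.
split; first exact: zero_connectedX.
have [side Hs] := bipartite Gs Gi cycles4.
exact: (not_one_connectedX Gs Hs uv).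
Qed.

Lemma conn_eq_m1_graph m (x : {ffun 'I_m.+3 -> 'I_n}) :
  ~ bicyclic G -> cycle_in G x -> m != 1%N -> conn_eq_m1 (R:=R) X.
Proof.
move=> NB cx m1; have Gs := graph_of_sym E; have Gi := graph_of_irr E.
have [f [g [Hf Hg fg]]] := two_windings Gs Gi cx NB m1.
have fX : X (vertex R f) by apply: vertexX => u v; apply: Hf; rewrite inE.
have gX : X (vertex R g) by apply: vertexX => u v; apply: Hg; rewrite inE.
split; first by exists (vertex R f).
move=> [_ /(_ _ _ fX gX) /(path_winding Gs cx)].
exact/eqP.
Qed.

Lemma not_conn_eq_m1_0 : conn_eq_m1 (R:=R) X -> ~ conn_eq_0 (R:=R) X.
Proof. by move=> [_ h] [/h]. Qed.

Lemma cyc_edges_graph_of m (x : {ffun 'I_m.+3 -> 'I_n}) : injective x ->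
  cyc_edges x \subset E <-> cycle_in G x.
Proof.
move=> xI; split=> [/subsetP h|[_ h]].
  split=> // i; rewrite /graph_of (inj_eq xI) eq_sym Zk_addr1_neq.
  by apply: h; apply: imset_f.
by apply/subsetP => _ /imsetP[i _ ->]; have /andP[] := h i.
Qed.

(** Offsets m of the lengths m + 3 other than 4; with [L] equal to the number of vertices every
    possible length is covered. *)
Definition not4 L := [seq m <- iota 0 L | m != 1%N].

Lemma none_of_cyclesP : none_of (cycle_family n (not4 n)) E ->
  forall m (x : {ffun 'I_m.+3 -> 'I_n}), cycle_in G x -> m = 1%N.
Proof.
move=> /allP h m x cx; have xI := cx.1; apply/eqP/negPn/negP => m1.
have mn : (m < n)%N.
  by have := leq_card _ xI; rewrite !card_ord; apply: leq_trans; rewrite leqW.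
have /h : cyc_edges x \in cycle_family n (not4 n).
  rewrite mem_cycle_family; apply/hasP; exists m; first by rewrite mem_filter m1 mem_iota.
  by apply/cyclesP; exists x.
by move/negP; apply; apply/cyc_edges_graph_of.
Qed.

Lemma not_none_of_cyclesP : ~~ none_of (cycle_family n (not4 n)) E ->
  exists m (x : {ffun 'I_m.+3 -> 'I_n}), cycle_in G x /\ m != 1%N.
Proof.
move=> /allPn[C]; rewrite mem_cycle_family => /hasP[m].
rewrite mem_filter => /andP[m1 _] /cyclesP[x xI ->]; rewrite negbK => xE.
by exists m, x; split=> //; apply/cyc_edges_graph_of.
Qed.

End Deterministic.

Lemma pr_le_add (R : realType) (p : R) (T : finType) (s : seq T) (A B C : {set T} -> bool) :
  0 <= p -> p <= 1 -> (forall E, A E -> B E || C E) -> pr p s A <= pr p s B + pr p s C.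
Proof.
move=> p0 p1 h; rewrite /pr -ExD; apply: le_Ex => // E; have := h E.
case: (A E) => [|_]; last by rewrite addr_ge0 ?ler0n.
by move=> /(_ isT); case: (B E); case: (C E) => //= _; rewrite ?lerDl ?lerDr ?ler0n // addr0 // add0r.
Qed.

Section Bounds.
Variables (R : realType) (c : R) (n : nat).
Hypotheses (c0 : 0 < c) (c1 : c < 1) (n0 : (0 < n)%N).
Let p : R := c / n%:R.
Let p0 : 0 <= p := edge_prob_ge0 n (ltW c0).
Let p1 : p <= 1. Proof. exact: ltW (edge_prob_lt1 c1 n0). Qed.
Let s := enum (pairs n).

Definition prob_only4 : R := pr p s (none_of (cycle_family n (not4 n))).
Definition prob_m1 : R := gnp_prob p (fun G : rel 'I_n => conn_eq_m1 (R:=R) (Hom_space (R:=R) G (K 3))).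
Definition prob_0 : R := gnp_prob p (fun G : rel 'I_n => conn_eq_0 (R:=R) (Hom_space (R:=R) G (K 3))).

Let bad : R := pr p s (fun E => `[< bicyclic (graph_of E) >]).
Let empty : R := pr p s (fun E => [disjoint E & pairs n]).

Lemma prob_m1_0 : prob_m1 + prob_0 <= 1.
Proof.
rewrite /prob_m1 /prob_0 !gnp_probE addrC -lerBrDr -pr_compl; apply: pr_le => // E.
by move=> /asboolP h0; apply/asboolPn => /not_conn_eq_m1_0.
Qed.

Lemma prob_only4_le : prob_only4 <= prob_0 + empty.
Proof.
rewrite /prob_0 gnp_probE; apply: pr_le_add => // E h.
case: (boolP [disjoint E & pairs n]); rewrite ?orbT // => /pred0Pn[e /andP[/= eE]].
rewrite orbF => en; apply/asboolP.
have : #|e| == 2%N by move: en; rewrite inE.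
move=> /cards2P[u [v [uv euv]]].
apply: (@conn_eq_0_graph _ _ _ u v); first exact: none_of_cyclesP.
by rewrite /graph_of uv -euv.
Qed.

Lemma prob_not_only4_le : 1 - prob_only4 <= prob_m1 + bad.
Proof.
rewrite /prob_only4 -pr_compl /prob_m1 gnp_probE; apply: pr_le_add => // E.
move=> /not_none_of_cyclesP[m [x [cx m1]]].
have [b|nb] := pselect (bicyclic (graph_of E)); first by rewrite (introT (asboolP _) b) orbT.
by rewrite (introT (asboolP _) (conn_eq_m1_graph R nb cx m1)).
Qed.

End Bounds.

(** * Limits *)

Local Open Scope classical_set_scope.
Local Open Scope ring_scope.

Section Series.
Variable R : realType.
Implicit Types (c x K : R).

Definition log_sum x L : R := \sum_(k < L) x ^+ k.+1 / k.+1%:R.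

Lemma is_derive_log_sum x L :
  is_derive x 1 (fun y => log_sum y L) (\sum_(k < L) x ^+ k).
Proof.
elim: L => [|L IH].
  rewrite big_ord0 (_ : (fun y => _) = cst 0); first exact: is_derive_cst.
  by apply/funext => y; rewrite /log_sum big_ord0.
rewrite big_ord_recr /=.
rewrite (_ : (fun y => _) = (fun y => log_sum y L) +
    horner (L.+1%:R^-1 *: 'X^(L.+1))); last first.
  by apply/funext => y; rewrite /log_sum big_ord_recr /= fctE hornerZ hornerXn mulrC.
apply: is_deriveD; apply: is_derive_eq.
rewrite derivZ derivXn hornerZ hornerMn hornerXn /= -[x ^+ L *+ _]mulr_natl mulrA.
by rewrite mulVf ?mul1r // pnatr_eq0.
Qed.

Lemma geometric_sum x L : x != 1 -> \sum_(k < L) x ^+ k = (1 - x ^+ L) / (1 - x).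
Proof.
move=> x1; have nz : 1 - x != 0 by rewrite subr_eq0 eq_sym.
elim: L => [|L IH]; first by rewrite big_ord0 expr0 subrr mul0r.
by rewrite big_ord_recr /= IH exprS; field.
Qed.

(** The remainder of the Taylor series vanishes at 0 and has derivative x^L/(1-x), so the mean value
    theorem bounds it. *)
Lemma log_sum_bounds c L : 0 < c -> c < 1 ->
  log_sum c L <= - ln (1 - c) <= log_sum c L + c ^+ L / (1 - c).
Proof.
move=> c0 c1.
pose f x := - ln (1 - x) - log_sum x L.
have df x : x < 1 -> is_derive x 1 f (x ^+ L / (1 - x)).
  move=> x1; have x1' : 0 < 1 - x by rewrite subr_gt0.
  have d1 : is_derive x 1 (fun y : R => 1 - y) (-1).
    have := @is_deriveB _ _ _ (cst (1 : R)) id x 1 0 1 _ _; rewrite sub0r; apply.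
  have d2 : is_derive x 1 (fun y => ln (1 - y)) (- (1 - x)^-1).
    have := @is_derive1_comp R (@ln R) (fun y => 1 - y) x ((1 - x)^-1) (-1) (is_derive1_ln x1') d1.
    by rewrite mulrN1.
  have := is_deriveB (is_deriveN d2) (is_derive_log_sum x L).
  rewrite opprK geometric_sum ?lt_eqF //.
  rewrite (_ : (1 - x)^-1 - _ = x ^+ L / (1 - x)) //.
  by rewrite -[X in X - _]mul1r -mulrBl; congr (_ / _); ring.
have f0 : f 0 = 0.
  rewrite /f subr0 ln1 oppr0 sub0r /log_sum big1 ?oppr0 // => k _.
  by rewrite expr0n /= mul0r.
have [] := @MVT_segment R f (fun x => x ^+ L / (1 - x)) 0 c (ltW c0).
- by move=> x; rewrite in_itv /= => /andP[_ xc]; apply: df; lra.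
- apply: derivable_within_continuous => x; rewrite in_itv /= => /andP[_ xc].
  by have [] : is_derive x 1 f (x ^+ L / (1 - x)) by apply: df; lra.
move=> x; rewrite in_itv /= => /andP[x0 xc]; rewrite f0 !subr0 => fc.
have x1' : 0 < 1 - x by lra.
have c1' : 0 < 1 - c by lra.
have fge : 0 <= f c by rewrite fc mulr_ge0 ?(ltW c0) // divr_ge0 ?exprn_ge0 // ltW.
have fle : f c <= c ^+ L / (1 - c).
  rewrite fc; apply: (@le_trans _ _ (x ^+ L / (1 - x))).
    by rewrite ler_piMr ?(ltW c1) // divr_ge0 ?exprn_ge0 // ltW.
  apply: ler_pM; rewrite ?exprn_ge0 ?invr_ge0 ?(ltW x1') //.
    by apply: lerXn2r; rewrite ?nnegrE // ltW.
  by rewrite lef_pV2 ?posrE //; lra.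
by move: fge fle; rewrite /f; lra.
Qed.

Lemma cvg_log_sum c : 0 < c -> c < 1 -> log_sum c @ \oo --> - ln (1 - c).
Proof.
move=> c0 c1.
have lim0 : (fun L => - ln (1 - c) - c ^+ L / (1 - c)) @ \oo --> - ln (1 - c).
  suff : (fun L => - ln (1 - c) - c ^+ L / (1 - c)) @ \oo -->
      - ln (1 - c) - 0 / (1 - c) by rewrite mul0r subr0.
  apply: cvgB; first exact: cvg_cst.
  apply: cvgM; last exact: cvg_cst.
  by apply: cvg_expr; rewrite ger0_norm // ltW.
apply: squeeze_cvgr lim0 (cvg_cst (- ln (1 - c))).
by near=> L; have := log_sum_bounds L c0 c1; lra.
Unshelve. all: by end_near.
Qed.

(** The series of (m+1)^2 c^m has sum (1+c)/(1-c)^3; its partial sums have a closed form with a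
    nonnegative remainder, checked by induction. *)
Lemma sum_sqr_geometric_le c N : 0 <= c -> c < 1 ->
  \sum_(m < N) m.+1%:R ^+ 2 * c ^+ m.+2 <= (1 + c) / (1 - c) ^+ 3.
Proof.
move=> c0 c1; have c1' : 0 < 1 - c by rewrite subr_gt0.
have E : (1 - c) ^+ 3 * (\sum_(m < N) m.+1%:R ^+ 2 * c ^+ m) =
    1 + c - c ^+ N * ((N%:R * (1 - c) + 1) ^+ 2 + c).
  elim: N => [|N IH]; first by rewrite big_ord0 expr0; ring.
  by rewrite big_ord_recr /= mulrDr IH [c ^+ N.+1]exprS -[N.+1%:R]natr1; ring.
rewrite ler_pdivlMr ?exprn_gt0 // mulrC.
apply: (@le_trans _ _ ((1 - c) ^+ 3 * (\sum_(m < N) m.+1%:R ^+ 2 * c ^+ m))).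
  rewrite ler_pM2l ?exprn_gt0 //; apply: ler_sum => m _.
  rewrite ler_wpM2l ?sqr_ge0 //; apply: ler_wiXn2l; rewrite ?(ltW c1) //.
  by rewrite -addn2 leq_addr.
by rewrite E gerBl mulr_ge0 ?exprn_ge0 // addr_ge0 // sqr_ge0.
Qed.

Lemma cvg_div_natr K : (fun n : nat => K / n%:R) @ \oo --> (0 : R).
Proof.
rewrite -(mulr0 K); apply: cvgM; first exact: cvg_cst.
apply/gtr0_cvgV0; last exact: cvgr_idn.
by near=> n; rewrite ltr0n; near: n; apply: nbhs_infty_gt.
Unshelve. all: by end_near.
Qed.

End Series.

(** The logarithmic series starts at k = 1, so its first two terms are removed, as is the term c^4/8
    of the 4-cycles, which is present once L > 1. *)
Lemma sum_not4 (R : realType) (c : R) L : (1 < L)%N ->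
  \sum_(m <- not4 L) cycle_weight c m =
  (log_sum c L.+2 - c - c ^+ 2 / 2) / 2 - c ^+ 4 / 8.
Proof.
move=> L1; have -> : \sum_(m <- not4 L) cycle_weight c m =
    \sum_(m < L) cycle_weight c m - c ^+ 4 / 8.
  rewrite /not4 big_filter -(big_mkord xpredT (cycle_weight c)) /index_iota subn0.
  rewrite [in RHS](bigD1_seq 1%N) ?iota_uniq ?mem_iota //=.
  by rewrite addrAC /cycle_weight subrr add0r.
have -> : log_sum c L.+2 = c + c ^+ 2 / 2 + \sum_(m < L) c ^+ m.+3 / m.+3%:R.
  by rewrite /log_sum !big_ord_recl /= expr1 divr1 addrA.
rewrite (_ : \sum_(m < L) c ^+ m.+3 / m.+3%:R = 2 * \sum_(m < L) cycle_weight c m).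
  by field.
rewrite mulr_sumr; apply: eq_bigr => m _; rewrite /cycle_weight natrM.
have : m.+3%:R != 0 :> R by rewrite pnatr_eq0.
by move: (m.+3%:R : R) => y y0; field.
Qed.

(** * Limit of the probability that all cycles have length four *)

Section Limit.
Variables (R : realType) (c : R).
Hypotheses (c0 : 0 < c) (c1 : c < 1).
Let c' : R := ln (1 - c) / 2 + c / 2 + c ^+ 2 / 4 + c ^+ 4 / 8.

Lemma sum_not4_le L : (1 < L)%N -> \sum_(m <- not4 L) cycle_weight c m <= - c'.
Proof.
by move=> L1; rewrite sum_not4 //; have := log_sum_bounds L.+2 c0 c1; rewrite /c'; lra.
Qed.

Lemma cvg_sum_not4 : (fun L => \sum_(m <- not4 L) cycle_weight c m) @ \oo --> - c'.
Proof.
have -> : - c' = (- ln (1 - c) - c - c ^+ 2 / 2) / 2 - c ^+ 4 / 8 by rewrite /c'; field.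
have lim : (fun L => (log_sum c (L + 2) - c - c ^+ 2 / 2) / 2 - c ^+ 4 / 8) @ \oo -->
    (- ln (1 - c) - c - c ^+ 2 / 2) / 2 - c ^+ 4 / 8.
  apply: cvgB; last exact: cvg_cst.
  apply: cvgM; last exact: cvg_cst.
  apply: cvgB; last exact: cvg_cst.
  apply: cvgB; last exact: cvg_cst.
  by rewrite (@cvg_shiftn 2%N R (log_sum c)); apply: cvg_log_sum.
apply: cvg_trans lim; apply: near_eq_cvg; near=> L.
rewrite sum_not4 ?addn2 //; near: L; exact: nbhs_infty_gt.
Unshelve. all: by end_near.
Qed.

Lemma prob_only4_ge n : (1 < n)%N -> expR (c' / (1 - c / n%:R)) <= prob_only4 c n.
Proof.
move=> n1; have n0 : (0 < n)%N by apply: ltnW.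
apply: le_trans (pr_no_cycle_ge (ltW c0) c1 n0 (not4 n)); rewrite ler_expR.
have p1 := edge_prob_lt1 c1 n0.
rewrite ler_pM2r ?invr_gt0 ?subr_gt0 // -lerN2 opprK.
exact: sum_not4_le.
Qed.

(** Avoiding fewer cycles is more likely. For fixed [L] the constant [overlap_bound] does not depend
    on [n], so the error vanishes in the limit. *)
Lemma prob_only4_le_trunc L n : (0 < n)%N -> (L <= n)%N ->
  prob_only4 c n <=
  expR (- \sum_(m <- not4 L) cycle_weight c m + overlap_bound R (not4 L) / n%:R).
Proof.
move=> n0 Ln; have uL : uniq (not4 L) by rewrite filter_uniq // iota_uniq.
apply: le_trans (pr_no_cycle_le (ltW c0) c1 n0 uL).
apply: pr_le; [exact: edge_prob_ge0 (ltW c0)|exact: ltW (edge_prob_lt1 c1 n0)|].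
move=> E /allP h; apply/allP => C; rewrite mem_cycle_family => /hasP[m].
rewrite mem_filter mem_iota /= => /andP[m1 mL] Cm; apply: h.
rewrite mem_cycle_family; apply/hasP; exists m => //.
by rewrite mem_filter m1 mem_iota /= (leq_trans mL).
Qed.

Lemma cvg_prob_only4 : prob_only4 c @ \oo --> expR c'.
Proof.
apply/cvgrPdist_lt => e e0.
have cvgp : (fun n : nat => c / n%:R) @ \oo --> (0 : R) by apply: cvg_div_natr.
have lower : (fun n : nat => expR (c' / (1 - c / n%:R))) @ \oo --> expR c'.
  apply: continuous_cvg; first exact: continuous_expR.
  suff : (fun n : nat => c' / (1 - c / n%:R)) @ \oo --> c' / (1 - 0) by rewrite subr0 divr1.
  apply: cvgM; first exact: cvg_cst.
  apply: cvgV; first by rewrite subr0 oner_eq0.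
  by apply: cvgB; [exact: cvg_cst|exact: cvgp].
have SL : (fun L => expR (- \sum_(m <- not4 L) cycle_weight c m)) @ \oo --> expR c'.
  apply: continuous_cvg; first exact: continuous_expR.
  by rewrite -[X in _ --> X]opprK; apply: cvgN; apply: cvg_sum_not4.
(* The truncation [L] is chosen from [e] alone, before [n] grows. *)
have [L HL] : exists L, expR (- \sum_(m <- not4 L) cycle_weight c m) < expR c' + e.
  have : \forall L \near \oo, `|expR c' - expR (- \sum_(m <- not4 L) cycle_weight c m)| < e.
    by move/cvgrPdist_lt : SL; apply.
  move=> /filter_ex[L]; rewrite ltr_distlC => /andP[_ h]; exists L; lra.
have upper : (fun n : nat => expR (- \sum_(m <- not4 L) cycle_weight c m +
    overlap_bound R (not4 L) / n%:R)) @ \oo -->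
    expR (- \sum_(m <- not4 L) cycle_weight c m).
  apply: continuous_cvg; first exact: continuous_expR.
  rewrite -[X in _ --> X]addr0; apply: cvgD; first exact: cvg_cst.
  exact: cvg_div_natr.
near=> n.
have n1 : (1 < n)%N by near: n; apply: nbhs_infty_gt.
have Ln : (L <= n)%N by near: n; apply: nbhs_infty_ge.
have h1 := prob_only4_ge n1.
have h2 := prob_only4_le_trunc (ltnW n1) Ln.
have h3 : expR c' - e < expR (c' / (1 - c / n%:R)).
  have : `|expR c' - expR (c' / (1 - c / n%:R))| < e.
    by near: n; move/cvgrPdist_lt : lower; apply.
  by rewrite ltr_distlC => /andP[h _]; lra.
have h4 : expR (- \sum_(m <- not4 L) cycle_weight c m +
    overlap_bound R (not4 L) / n%:R) < expR c' + e.
  by near: n; apply: (cvgr_lt _ upper).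
by rewrite ltr_distlC; lra.
Unshelve. all: by end_near.
Qed.

Lemma pr_bicyclic_le_div n : (0 < n)%N ->
  pr (c / n%:R) (enum (pairs n)) (fun E => `[< bicyclic (graph_of E) >]) <=
  (1 + c) / (1 - c) ^+ 3 / n%:R.
Proof.
move=> n0; apply: le_trans (pr_bicyclic_le (ltW c0) c1 n0) _.
by rewrite ler_wpM2r ?invr_ge0 // sum_sqr_geometric_le // ltW.
Qed.

(** The bound exp(-y) <= 1/(1+y) is enough and gives the same 1/n shape as the other error. *)
Lemma pr_no_edge_le_div n : (0 < n)%N ->
  pr (c / n%:R) (enum (pairs n)) (fun E => disjoint (mem E) (mem (pairs n))) <=
  2 / c / n%:R.
Proof.
move=> n0; apply: le_trans (pr_no_edge_le (ltW c0) c1 n0) _.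
have n0R : 0 < n%:R :> R by rewrite ltr0n.
have cn : 0 < c * n%:R / 2 by rewrite divr_gt0 // mulr_gt0.
rewrite expRN (_ : 2 / c / n%:R = (c * n%:R / 2)^-1); last first.
  by field; rewrite !gt_eqF.
rewrite lef_pV2 ?posrE ?expR_gt0 //.
apply: le_trans (expR_ge1Dx _).
have -> : 1 + c * (n%:R - 1) / 2 = c * n%:R / 2 + (1 - c / 2) by field.
by rewrite lerDl subr_ge0 ler_pdivrMr // mul1r (le_trans (ltW c1)) // ler1n.
Qed.

End Limit.

Theorem theorem5p4 (R : realType) (c : R) (hc0 : 0 < c) (hc1 : c < 1) :
  let c' := ln (1 - c) / 2 + c / 2 + c ^+ 2 / 4 + c ^+ 4 / 8 in
  ((fun n : nat =>
      gnp_prob (c / n%:R) (fun G : rel 'I_n => conn_eq_m1 (R:=R) (Hom_space (R:=R) G (K 3))))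
     @ \oo --> 1 - expR c') /\
  ((fun n : nat =>
      gnp_prob (c / n%:R) (fun G : rel 'I_n => conn_eq_0 (R:=R) (Hom_space (R:=R) G (K 3))))
     @ \oo --> expR c').
Proof.
move=> c'; have Q : prob_only4 c @ \oo --> expR c' by apply: cvg_prob_only4.
have err (k : R) : (fun n : nat => k / n%:R) @ \oo --> (0 : R) by apply: cvg_div_natr.
pose kb := (1 + c) / (1 - c) ^+ 3; pose ke := 2 / c.
(* The graph-theoretic implications give the two lower bounds; each upper bound is the other lower
   bound, since the two events exclude each other. *)
have bounds : \forall n \near \oo,
    1 - prob_only4 c n - kb / n%:R <= prob_m1 c n <= 1 - prob_only4 c n + ke / n%:R /\
    prob_only4 c n - ke / n%:R <= prob_0 c n <= prob_only4 c n + kb / n%:R.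
  near=> n; have n0 : (0 < n)%N by near: n; apply: nbhs_infty_gt.
  have h1 := prob_m1_0 hc0 hc1 n0; have h2 := prob_only4_le hc0 hc1 n0.
  have h3 := prob_not_only4_le hc0 hc1 n0.
  have h4 := pr_bicyclic_le_div hc0 hc1 n0; have h5 := pr_no_edge_le_div hc0 hc1 n0.
  by rewrite /kb /ke; split; lra.
split.
  apply: (@squeeze_cvgr _ _ _ _ (fun n => 1 - prob_only4 c n - kb / n%:R)
    (fun n => 1 - prob_only4 c n + ke / n%:R)).
  - by apply: filterS bounds => n [].
  - rewrite -[X in _ --> X]subr0; apply: cvgB; last exact: err.
    by apply: cvgB; [exact: cvg_cst|exact: Q].
  - rewrite -[X in _ --> X]addr0; apply: cvgD; last exact: err.
    by apply: cvgB; [exact: cvg_cst|exact: Q].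
apply: (@squeeze_cvgr _ _ _ _ (fun n => prob_only4 c n - ke / n%:R)
  (fun n => prob_only4 c n + kb / n%:R)).
- by apply: filterS bounds => n [].
- by rewrite -[X in _ --> X]subr0; apply: cvgB; [exact: Q|exact: err].
- by rewrite -[X in _ --> X]addr0; apply: cvgD; [exact: Q|exact: err].
Unshelve. all: by end_near.
Qed.
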